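(* Let $\mathbf K'_*$ be a class of graphs that is closed under limits (the union of any increasing continuous chain of graphs in $\mathbf K'_*$, each an induced subgraph of the next, belongs to $\mathbf K'_*$), and let $\mathbf K_*$ be the class of right-angled Coxeter groups $A$ whose Coxeter graph $\Gamma_A$ is isomorphic to a member of $\mathbf K'_*$. Suppose every $B\in\mathbf K_*$ is strongly rigid. Then: (1) $\mathbf K_*$ and $\preccurlyeq$ are closed under isomorphism; (2) if $A\preccurlyeq B$ then $A$ is a subgroup of $B$; (3) $\preccurlyeq$ is a partial order on $\mathbf K_*$; (4.1) for every increasing continuous $\preccurlyeq$-chain $(A_i)_{i<\delta}$ in $\mathbf K_*$, $\bigcup_{i<\delta}A_i\in\mathbf K_*$; (4.2) for such a chain, $A_j\preccurlyeq\bigcup_{i<\delta}A_i$ for every $j<\delta$; (5) if $A,B,C\in\mathbf K_*$, $A\preccurlyeq C$, $B\preccurlyeq C$ and $A$ is a subgroup of $B$, then $A\preccurlyeq B$. Furthermore $\mathrm{LS}(\mathbf K_*,\preccurlyeq)=\mathrm{LS}(\mathbf K'_*,\leq)$, and if $(\mathbf K'_*,\leq)$ has the amalgamation property, the joint embedding property and arbitrarily large models, then so does $(\mathbf K_*,\preccurlyeq)$.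
   Context: A right-angled Coxeter group is a group $W$ with a presentation whose generating set $S$ (a Coxeter basis, possibly infinite) satisfies only relations $s^2=e$ and $(ss')^2=e$ for some pairs of distinct $s,s'\in S$; its Coxeter graph has vertex set $S$, distinct $s,s'$ adjacent iff they commute (well defined up to isomorphism). $W$ is strongly rigid if for any two Coxeter bases $S,S'$ there is $g\in W$ with $gSg^{-1}=S'$. $A\preccurlyeq B$ iff $A$ is a subgroup of $B$ and some Coxeter basis $S$ of $B$ has $A\cap S$ a Coxeter basis of $A$. For graphs, $\leq$ is the induced subgraph relation. A chain $(A_i)_{i<\delta}$ is increasing if $A_i\preccurlyeq A_j$ for $i<j$ and continuous if $A_j=\bigcup_{i<j}A_i$ at limits. For a pair $(\mathbf K,\preccurlyeq)$ in a vocabulary $L$, $\mathrm{LS}(\mathbf K,\preccurlyeq)$ is the least infinite cardinal $\lambda$ such that for every $A\in\mathbf K$ and $X\subseteq A$ there is $C\in\mathbf K$ with $X\subseteq C\preccurlyeq A$ and $|C|\le|X|+|L|+\lambda$. A $\preccurlyeq$-embedding $f:A\to B$ is an embedding with $f(A)\preccurlyeq B$. Amalgamation property: whenever $A\preccurlyeq B_0,B_1$ there are $C$ and $\preccurlyeq$-embeddings $f_i:B_i\to C$ agreeing on $A$. Joint embedding: any $B_0,B_1$ $\preccurlyeq$-embed into a common $C$. Arbitrarily large models: the class has a member of cardinality $\lambda$ for every $\lambda\ge\mathrm{LS}$.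
   Formalization: The class of graphs K'_* is additionally assumed closed under isomorphism; without this, (4.1) can fail, e.g. for finite graphs on pairwise disjoint vertex sets, where closure under limits is vacuous. *)

(* Defs.v *)
From mathcomp Require Import all_boot all_order.
From mathcomp Require Import boolp classical_sets functions cardinality.

Set Implicit Arguments.
Unset Strict Implicit.
Unset Printing Implicit Defensive.

Local Open Scope classical_set_scope.
Local Open Scope card_scope.

(* A pair (K, ≼) in a vocabulary.  A subset A of a structure M stands for the
   substructure of M with domain A, so that inclusions and unions of structures
   are literal; M itself is represented by [set: M].  For a chain of structures
   no generality is lost, since the union of the chain is a possible M.
     isom A B f : f restricts to an isomorphism from A onto B
     member A   : the substructure A belongs to K
     strong A B : A ≼ B *)
Record structure_class := StructureClass {
  structure : Type;
  dom : structure -> Type;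
  vocabulary : Type;
  isom : forall M N : structure,
    set (dom M) -> set (dom N) -> (dom M -> dom N) -> Prop;
  member : forall M : structure, set (dom M) -> Prop;
  strong : forall M : structure, set (dom M) -> set (dom M) -> Prop }.

Arguments dom {s} _.
Arguments isom {s M N} _ _ _.
Arguments member {s M} _.
Arguments strong {s M} _ _.

Section StructureClass.
Variable K : structure_class.

Definition member_iso_closed :=
  forall (M N : structure K) (A : set (dom M)) (B : set (dom N)) f,
    isom A B f -> member A -> member B.

Definition strong_iso_closed :=
  forall (M N : structure K) (A B : set (dom M)) (B' : set (dom N)) f,
    isom B B' f -> strong A B -> strong (f @` A) B'.

Definition strong_partial_order :=
  forall M : structure K,
  [/\ forall A : set (dom M), member A -> strong A A,
      forall A B : set (dom M), member A -> member B ->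
        strong A B -> strong B A -> A = B
    & forall A B C : set (dom M), member A -> member B -> member C ->
        strong A B -> strong B C -> strong A C].

Definition is_limit (d : Order.disp_t) (I : orderType d) (j : I) :=
  (exists i : I, (i < j)%O) /\
  (forall i : I, (i < j)%O -> exists k : I, (i < k)%O && (k < j)%O).

(* The ordinal δ > 0 is given as a nonempty well-ordered type I. *)
Definition continuous_chain (d : Order.disp_t) (I : orderType d)
    (M : structure K) (A : I -> set (dom M)) :=
  [/\ inhabited I,
      well_founded (fun i j : I => (i < j)%O),
      forall i, member (A i),
      forall i j, (i < j)%O -> strong (A i) (A j)
    & forall j, is_limit j -> A j = \bigcup_(i in [set i | (i < j)%O]) A i].

Definition closed_under_limits :=
  forall (d : Order.disp_t) (I : orderType d) (M : structure K)
    (A : I -> set (dom M)),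
  continuous_chain A -> member (\bigcup_i A i).

Definition strong_in_limits :=
  forall (d : Order.disp_t) (I : orderType d) (M : structure K)
    (A : I -> set (dom M)),
  continuous_chain A -> forall j, strong (A j) (\bigcup_i A i).

(* Cardinals are represented by types; |X| + |L| + λ is the cardinal of a
   disjoint sum. *)
Definition LS_property (Lambda : Type) :=
  forall (M : structure K) (A X : set (dom M)), member A -> X `<=` A ->
  exists C : set (dom M), [/\ member C, X `<=` C, strong C A
    & C #<= [set: X + vocabulary K + Lambda]].

(* [is_LS Lambda] reads "LS(K, ≼) exists and is the cardinal of Lambda". *)
Definition is_LS (Lambda : Type) :=
  [/\ infinite_set [set: Lambda], LS_property Lambda
    & forall Mu : Type, infinite_set [set: Mu] -> LS_property Mu ->
        [set: Lambda] #<= [set: Mu]].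

Definition strong_embedding (M N : structure K) (f : dom M -> dom N) :=
  isom [set: dom M] (range f) f /\ strong (range f) [set: dom N].

Definition amalgamation_property :=
  forall (A B0 B1 : structure K) (e0 : dom A -> dom B0) (e1 : dom A -> dom B1),
    member [set: dom A] -> member [set: dom B0] -> member [set: dom B1] ->
    strong_embedding e0 -> strong_embedding e1 ->
  exists (C : structure K) (f0 : dom B0 -> dom C) (f1 : dom B1 -> dom C),
    [/\ member [set: dom C], strong_embedding f0, strong_embedding f1
      & forall a, f0 (e0 a) = f1 (e1 a)].

Definition joint_embedding_property :=
  forall B0 B1 : structure K,
    member [set: dom B0] -> member [set: dom B1] ->
  exists (C : structure K) (f0 : dom B0 -> dom C) (f1 : dom B1 -> dom C),
    [/\ member [set: dom C], strong_embedding f0 & strong_embedding f1].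

Definition arbitrarily_large_models :=
  exists2 Kappa : Type, is_LS Kappa &
    forall Lambda : Type, [set: Kappa] #<= [set: Lambda] ->
    exists2 A : structure K, member [set: dom A]
      & [set: dom A] #= [set: Lambda].

End StructureClass.

Record graph := Graph {
  vertex :> Type;
  adj : vertex -> vertex -> Prop;
  adj_sym : forall x y, adj x y -> adj y x;
  adj_irr : forall x, ~ adj x x }.

Arguments adj {g} _ _.

Definition graph_isom (G H : graph) (A : set G) (B : set H) (f : G -> H) :=
  set_bij A B f /\
  (forall x y, A x -> A y -> (adj x y <-> adj (f x) (f y))).

Definition isomorphic_graphs (G H : graph) :=
  exists f : G -> H, graph_isom [set: G] [set: H] f.

Definition induced (G : graph) (A : set G) : graph :=
  @Graph A (fun x y => adj (val x) (val y))
    (fun x y => @adj_sym G (val x) (val y)) (fun x => @adj_irr G (val x)).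

Inductive graph_symbol := sym_adj.

(* The pair (K', ≤), ≤ being the induced subgraph relation. *)
Definition graph_class (K' : graph -> Prop) : structure_class :=
  @StructureClass graph vertex graph_symbol graph_isom
    (fun G A => K' (@induced G A))
    (fun G A B => A `<=` B).

(* (x, false) is the letter x and (x, true) its formal inverse. *)
Definition word (I : Type) := seq (I * bool).

(* Equality in the group presented by <I | R>. *)
Inductive word_eq (I : Type) (R : set (word I)) : word I -> word I -> Prop :=
| word_eq_refl w : word_eq R w w
| word_eq_sym w w' : word_eq R w w' -> word_eq R w' w
| word_eq_trans w w' w'' :
    word_eq R w w' -> word_eq R w' w'' -> word_eq R w w''
| word_eq_cancel u v x b : word_eq R (u ++ (x, b) :: (x, ~~ b) :: v) (u ++ v)
| word_eq_relator u v r : R r -> word_eq R (u ++ r ++ v) (u ++ v).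

Section Groups.
Local Open Scope group_scope.

Definition word_eval (I : Type) (G : groupType) (g : I -> G) (w : word I) : G :=
  \prod_(x <- w) (if x.2 then (g x.1)^-1 else g x.1).

Definition has_presentation (G : groupType) (A : set G)
    (I : Type) (g : I -> G) (R : set (word I)) :=
  range (word_eval g) = A /\
  (forall w w', word_eval g w = word_eval g w' <-> word_eq R w w').

Definition is_subgroup (G : groupType) (A : set G) := group_closed (mem A).

Definition subgroup_of (G : groupType) (A B : set G) :=
  [/\ is_subgroup A, is_subgroup B & A `<=` B].

Definition group_isom (G H : groupType) (A : set G) (B : set H) (f : G -> H) :=
  [/\ is_subgroup A, is_subgroup B, set_bij A B f
    & forall x y, A x -> A y -> f (x * y) = f x * f y].

Definition right_angled_relators (S : Type) (E : S -> S -> Prop) :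
    set (word S) :=
  [set r | (exists s, r = [:: (s, false); (s, false)]) \/
           (exists s t, [/\ s <> t, E s t &
              r = [:: (s, false); (t, false); (s, false); (t, false)]])].

(* In particular S is contained in A and A is a subgroup of G. *)
Definition coxeter_basis (G : groupType) (A S : set G) :=
  exists E : S -> S -> Prop,
    has_presentation A (fun s : S => val s) (right_angled_relators E).

Definition coxeter_adj (G : groupType) (S : set G) (s t : S) :=
  s <> t /\ val s * val t = val t * val s.

Lemma coxeter_adj_sym (G : groupType) (S : set G) (s t : S) :
  coxeter_adj s t -> coxeter_adj t s.
Proof. by move=> [st e]; split=> // ts; apply: st. Qed.

Lemma coxeter_adj_irr (G : groupType) (S : set G) (s : S) : ~ coxeter_adj s s.
Proof. by case. Qed.

Definition coxeter_graph (G : groupType) (S : set G) : graph :=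
  Graph (@coxeter_adj_sym G S) (@coxeter_adj_irr G S).

Definition strongly_rigid (G : groupType) (A : set G) :=
  forall S S' : set G, coxeter_basis A S -> coxeter_basis A S' ->
  exists2 g, A g & [set g * s * g^-1 | s in S] = S'.

(* The relation A ≼ B. *)
Definition special_subgroup (G : groupType) (A B : set G) :=
  subgroup_of A B /\
  exists2 S : set G, coxeter_basis B S & coxeter_basis A (A `&` S).

Inductive group_symbol := sym_one | sym_mul | sym_inv.

(* The pair (K_*, ≼): A belongs to K_* iff its Coxeter graph, taken with respect
   to some Coxeter basis, is isomorphic to a member of K'. *)
Definition coxeter_class (K' : graph -> Prop) : structure_class :=
  @StructureClass groupType (fun G : groupType => G) group_symbol group_isom
    (fun G A => exists2 S : set G, coxeter_basis A S &
       exists2 Gamma, K' Gamma & isomorphic_graphs (coxeter_graph S) Gamma)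
    special_subgroup.

End Groups.

(* Main.v *)
Require Import Defs.
From HB Require Import structures.
From mathcomp Require Import all_boot all_order.
From mathcomp Require Import boolp classical_sets functions cardinality.
From mathcomp Require Import fingroup perm.

(* A Coxeter basis is characterised by a universal property: an assignment of
   the basis that respects the right-angled relations extends to a homomorphism.
   Killing a set of generators respects them, so every special subgroup is a
   retract; this retraction replaces all combinatorics of reduced words.  If
   [A <= g B g^-1] with [A], [B] spanned by parts of one basis and [rho] is the
   retraction onto [B], then [h = g (rho g)^-1] centralises [A] and
   [h B h^-1 = g B g^-1], which gives coherence (5).
   Strong rigidity makes bases extendable: if [A ≼ B], every basis of [A] is the
   trace on [A] of a basis of [B].  Transitivity follows, and along a continuous
   chain a coherent increasing family of bases is obtained by transfinite
   recursion; its union is a basis of the limit, with Coxeter graph the union of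
   the Coxeter graphs.  Finally a graph is the Coxeter graph of the group it
   presents, embeddings of graphs induce special embeddings of groups, and the
   group has the cardinal of the graph when this is infinite, so that the
   Löwenheim-Skolem number, amalgamation, joint embedding and large models
   transfer between the two classes. *)

Set Implicit Arguments.
Unset Strict Implicit.
Unset Printing Implicit Defensive.

Local Open Scope classical_set_scope.
Local Open Scope card_scope.

(** * Cardinal arithmetic *)

Lemma card_le_inj (T U : Type) (A : set T) (B : set U) (f : T -> U) :
  set_fun A B f -> set_inj A f -> A #<= B.
Proof.
move=> fAB finj; have [h] : $|{injfun A >-> B}| by apply/injfunPex; exists f.
exact: inj_card_le h.
Qed.

Lemma card_le_exists (T U : Type) (A : set T) (B : set U) :
  A #<= B -> exists f : A -> B, injective f.
Proof.
move=> /card_leP[f]; exists f => x y.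
by apply: (@inj _ _ _ f); apply/mem_set.
Qed.

Lemma card_leT_exists (T U : Type) :
  [set: T] #<= [set: U] -> exists f : T -> U, injective f.
Proof.
move=> /card_le_exists[f finj].
exists (fun x => val (f (SigSub (mem_set (I : [set: T] x))))) => x y.
by move=> /val_inj/finj[].
Qed.

Lemma infinite_nat_inj (T : Type) :
  infinite_set [set: T] <-> exists h : nat -> T, injective h.
Proof.
split=> [/infiniteP/card_leT_exists//|[h hinj]]; apply/infiniteP.
by apply: (card_le_inj (f := h)) => // x y _ _; apply: hinj.
Qed.

(** Zorn's lemma on graphs of partial injections from [A] to [B]: a maximal one is defined on all of
    [A] or reaches all of [B], since otherwise a pair of missed elements could be added. The points
    [a0] and [b0] serve as default values. *)
Lemma set_inj_total (T U : Type) (A : set T) (B : set U) :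
  A !=set0 -> B !=set0 ->
  (exists2 f : T -> U, set_fun A B f & set_inj A f) \/
  (exists2 f : U -> T, set_fun B A f & set_inj B f).
Proof.
move=> [a0 Aa0] [b0 Bb0].
pose P : set (set (T * U)) := [set R | [/\ forall p, R p -> A p.1 /\ B p.2,
  forall x y y', R (x, y) -> R (x, y') -> y = y' &
  forall x x' y, R (x, y) -> R (x', y) -> x = x']].
have [F FP Ftot|R [[RAB Rfun Rinj] Rmax]] := @Zorn_bigcup _ P.
  have pick p q : (\bigcup_(X in F) X) p -> (\bigcup_(X in F) X) q ->
      exists2 X, F X & X p /\ X q.
    move=> [X FX Xp] [Y FY Yq]; have [XY|YX] := Ftot _ _ FX FY.
      by exists Y => //; split=> //; apply: XY.
    by exists X => //; split=> //; apply: YX.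
  split=> [p [X /FP[+ _ _] Xp]|x y y' Xy Xy'|x x' y Xx Xx']; first exact.
    by have [X /FP[_ + _] []] := pick _ _ Xy Xy'; apply.
  by have [X /FP[_ _ +] []] := pick _ _ Xx Xx'; apply.
have [domR|/existsNP[a /not_implyP[Aa na]]] :=
  pselect (forall a, A a -> exists b, R (a, b)).
  left; have /choice[f fE] : forall a, exists b, A a -> R (a, b).
    move=> a; have [/domR[b ?]|nAa] := pselect (A a); first by exists b.
    by exists b0.
  exists f => [a /fE/RAB[]//|a a' /set_mem/fE Ra /set_mem/fE Ra' e].
  by apply: Rinj Ra _; rewrite e.
have [ranR|/existsNP[b /not_implyP[Bb nb]]] :=
  pselect (forall b, B b -> exists a, R (a, b)).
  right; have /choice[f fE] : forall b, exists a, B b -> R (a, b).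
    move=> b; have [/ranR[c ?]|nBb] := pselect (B b); first by exists c.
    by exists a0.
  exists f => [b /fE/RAB[]//|b b' /set_mem/fE Rb /set_mem/fE Rb' e].
  by apply: Rfun Rb _; rewrite e.
exfalso; apply: (Rmax (R `|` [set (a, b)])).
  split; first exact: subsetUl.
  by move=> /(_ (a, b)) Rab; apply: na; exists b; apply: Rab; right.
split=> [p [/RAB//|->//]|x y y'|x x' y];
  move=> [Rxy|[ex ey]] [Rxy'|[ex' ey']].
- exact: Rfun Rxy Rxy'.
- by case: na; exists y; rewrite -ex'.
- by case: na; exists y'; rewrite -ex.
- by rewrite ey ey'.
- exact: Rinj Rxy Rxy'.
- by case: nb; exists x; rewrite -ey'.
- by case: nb; exists x'; rewrite -ey.
- by rewrite ex ex'.
Qed.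

(* Hessenberg's theorem: a maximal injection [D * D -> D] with [D] infinite
   would extend to [D] together with a disjoint copy of [D], so the complement
   of [D] injects into [D]. *)
Section Pairing.
Variable Z : Type.

Record partial_pairing := PartialPairing {
  pp_dom : set Z;
  pp_fun : Z -> Z -> Z;
  pp_infinite : exists2 h : nat -> Z, injective h & forall n, pp_dom (h n);
  pp_closed : forall x y, pp_dom x -> pp_dom y -> pp_dom (pp_fun x y);
  pp_inj : forall x y x' y', pp_dom x -> pp_dom y -> pp_dom x' -> pp_dom y' ->
    pp_fun x y = pp_fun x' y' -> x = x' /\ y = y' }.

(** Only a preorder: two pairings with the same domain may differ outside it. *)
Definition pp_le (p q : partial_pairing) :=
  `[< pp_dom p `<=` pp_dom q /\
      forall x y, pp_dom p x -> pp_dom p y -> pp_fun p x y = pp_fun q x y >].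

Lemma pp_le_refl : reflexive pp_le.
Proof. by move=> p; apply/asboolP; split. Qed.

Lemma pp_le_trans : transitive pp_le.
Proof.
move=> q p r /asboolP[pq pqE] /asboolP[qr qrE]; apply/asboolP; split.
  exact: subset_trans pq qr.
by move=> x y px py; rewrite pqE // qrE //; apply: pq.
Qed.

(** Provides the element that Zorn's lemma starts from: the pairing of the naturals carried to the
    range of [h]. *)
Lemma pp_base (h : nat -> Z) : injective h -> inhabited partial_pairing.
Proof.
move=> hinj.
have /choice[k kE] : forall x, exists n, range h x -> h n = x.
  move=> x; have [[n _ <-]|nx] := pselect (range h x); first by exists n.
  by exists 0.
have kh n : k (h n) = n by apply: hinj; apply: kE; exists n.
apply: inhabits.
apply: (@PartialPairing (range h) (fun x y => h (pickle (k x, k y)))).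
- by exists h => // n; exists n.
- by move=> x y _ _; exists (pickle (k x, k y)).
move=> _ _ _ _ [x _ <-] [y _ <-] [x' _ <-] [y' _ <-].
by rewrite !kh => /hinj/(pcan_inj pickleK)[-> ->].
Qed.

Lemma pp_chain_ub (p0 : partial_pairing) (F : set partial_pairing) :
  total_on F pp_le -> exists q, forall p, F p -> pp_le p q.
Proof.
move=> Ftot; have [[p1 Fp1]|F0] := pselect (exists p, F p); last first.
  by exists p0 => p Fp; case: F0; exists p.
pose D := \bigcup_(p in F) pp_dom p.
have pick2 p q : F p -> F q -> exists r, [/\ F r, pp_le p r & pp_le q r].
  move=> Fp Fq; have [pq|qp] := Ftot _ _ Fp Fq.
    by exists q; rewrite pp_le_refl.
  by exists p; rewrite pp_le_refl.
(* For each pair of points, [idx] chooses a member of the chain whose domain contains both; by [fE]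
   the value does not depend on this choice. *)
have /choice[idx idxE] : forall xy : Z * Z, exists p,
    D xy.1 -> D xy.2 -> [/\ F p, pp_dom p xy.1 & pp_dom p xy.2].
  move=> [x y]; have [[p Fp px]|nDx] := pselect (D x); last by exists p0.
  have [[q Fq qy]|nDy] := pselect (D y); last by exists p0.
  have [r [Fr /asboolP[pr _] /asboolP[qr _]]] := pick2 _ _ Fp Fq.
  by exists r => _ _; split=> //; [apply: pr|apply: qr].
pose f x y := pp_fun (idx (x, y)) x y.
have fE p x y : F p -> pp_dom p x -> pp_dom p y -> pp_fun p x y = f x y.
  move=> Fp px py; have [||Fq qx qy] := idxE (x, y); [by exists p..|].
  have [r [_ /asboolP[_ pr] /asboolP[_ qr]]] := pick2 _ _ Fp Fq.
  by rewrite /f pr // qr.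
have common x y : D x -> D y -> exists p, [/\ F p, pp_dom p x & pp_dom p y].
  by move=> Dx Dy; exists (idx (x, y)); apply: idxE.
have Dinf : exists2 h : nat -> Z, injective h & forall n, D (h n).
  by have [h hinj hD] := pp_infinite p1; exists h => // n; exists p1.
have Dclosed x y : D x -> D y -> D (f x y).
  move=> Dx Dy; have [p [Fp px py]] := common _ _ Dx Dy.
  by exists p => //; rewrite -(fE p) //; apply: pp_closed.
have Dinj x y x' y' : D x -> D y -> D x' -> D y' -> f x y = f x' y' ->
    x = x' /\ y = y'.
  move=> Dx Dy Dx' Dy'; have [p [Fp px py]] := common _ _ Dx Dy.
  have [q [Fq qx qy]] := common _ _ Dx' Dy'.
  have [r [Fr /asboolP[pr _] /asboolP[qr _]]] := pick2 _ _ Fp Fq.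
  rewrite -!(fE r) //; try by [apply: pr|apply: qr].
  by apply: pp_inj; try by [apply: pr|apply: qr].
exists (PartialPairing Dinf Dclosed Dinj) => p Fp; apply/asboolP; split=> /=.
  by move=> x px; exists p.
by move=> x y px py; apply: fE.
Qed.

Lemma pp_extend (p : partial_pairing) (i : Z -> Z) :
  set_fun (pp_dom p) (~` pp_dom p) i -> set_inj (pp_dom p) i ->
  exists2 q, pp_le p q & ~~ pp_le q p.
Proof.
move=> iDE iinj; set D := pp_dom p in iDE iinj *; pose f := pp_fun p.
have [h hinj hD] := pp_infinite p.
have iI x y : D x -> D y -> i x = i y -> x = y.
  by move=> Dx Dy; apply: iinj; apply/mem_set.
pose D2 := D `|` i @` D.
(* [r] sends a point of [D] to itself and a point of the copy of [D] to its preimage under [i]. *)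
have /choice[r rE] : forall x, exists y, D2 x -> D y /\ (x = y \/ ~ D x /\ x = i y).
  move=> x; have [Dx|nDx] := pselect (D x); first by exists x; split=> //; left.
  have [[y Dy <-]|nx] := pselect ((i @` D) x); last by exists x => -[].
  by exists y => _; split=> //; right; split=> //; apply: iDE.
(* One of the four elements [h 0] to [h 3] of [D] records which arguments lie in [D]. The code of a
   new pair is pushed into the copy by [i], so it never meets an old value. *)
pose tag x y := h ((~~ `[< D x >]).*2 + ~~ `[< D y >]).
pose f2 x y := if `[< D x /\ D y >] then f x y else i (f (tag x y) (f (r x) (r y))).
have Dr x : D2 x -> D (r x) by move=> /rE[].
have fD x y : D x -> D y -> D (f x y) by apply: pp_closed.
have Dcode x y : D2 x -> D2 y -> D (f (tag x y) (f (r x) (r y))).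
  by move=> Dx Dy; apply: (fD); [apply: hD|apply: (fD); apply: Dr].
have rinj x y : D2 x -> D2 y -> `[< D x >] = `[< D y >] -> r x = r y -> x = y.
  move=> D2x D2y Dxy rxy; have [_] := rE _ D2x; have [_] := rE _ D2y.
  have Dry := Dr _ D2y; have DxyP : D x <-> D y.
    by split=> /asboolP; [rewrite Dxy|rewrite -Dxy] => /asboolP.
  rewrite rxy => -[ey|[nDy ey]] [ex|[nDx ex]].
  - exact: etrans ex (esym ey).
  - by case: nDx; apply/DxyP; rewrite ey.
  - by case: nDy; apply/DxyP; rewrite ex.
  - exact: etrans ex (esym ey).
have D2inf : exists2 h : nat -> Z, injective h & forall n, D2 (h n).
  by exists h => // n; left; apply: hD.
have D2closed x y : D2 x -> D2 y -> D2 (f2 x y).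
  move=> D2x D2y; rewrite /f2; case: asboolP => [[Dx Dy]|_].
    by left; apply: fD.
  by right; eexists; last reflexivity; apply: Dcode.
have D2inj x y x' y' : D2 x -> D2 y -> D2 x' -> D2 y' -> f2 x y = f2 x' y' ->
    x = x' /\ y = y'.
  move=> D2x D2y D2x' D2y'; rewrite /f2.
  case: asboolP => [[Dx Dy]|nxy]; case: asboolP => [[Dx' Dy']|nxy'].
  - exact: pp_inj.
  - move=> e; case: (iDE (f (tag x' y') (f (r x') (r y')))); first exact: Dcode.
    by rewrite -e; apply: fD.
  - move=> e; case: (iDE (f (tag x y) (f (r x) (r y)))); first exact: Dcode.
    by rewrite e; apply: fD.
  have [Dfx Dfx'] : D (f (r x) (r y)) /\ D (f (r x') (r y')).
    by split; apply: (fD); apply: (Dr).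
  move=> /(iI _ _ (Dcode _ _ D2x D2y) (Dcode _ _ D2x' D2y')).
  move=> /(pp_inj (hD _) Dfx (hD _) Dfx')[/hinj tagE].
  move=> /(pp_inj (Dr _ D2x) (Dr _ D2y) (Dr _ D2x') (Dr _ D2y'))[rx ry].
  have [ex ey] : `[< D x >] = `[< D x' >] /\ `[< D y >] = `[< D y' >].
    by case: `[< D x >] tagE; case: `[< D x' >]; case: `[< D y >];
      case: `[< D y' >].
  by split; apply: rinj.
exists (PartialPairing D2inf D2closed D2inj).
  apply/asboolP; split=> /= [|x y Dx Dy]; first exact: subsetUl.
  by rewrite /f2 asboolT.
apply/asboolP => -[/= D2D _]; apply: (iDE (h 0)); first exact: hD.
by apply: D2D; right; exists (h 0) => //; apply: hD.
Qed.

Lemma pairing_exists : infinite_set [set: Z] ->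
  exists f : Z -> Z -> Z, forall x y x' y', f x y = f x' y' -> x = x' /\ y = y'.
Proof.
move=> /infinite_nat_inj[h /pp_base[p0]].
have [p pmax] := ZL_preorder p0 pp_le_refl (fun r s t => @pp_le_trans s r t)
  (pp_chain_ub p0).
have [k kinj kD] := pp_infinite p; set D := pp_dom p in kD *; pose f := pp_fun p.
have [g gD ginj] : exists2 g : Z -> Z, forall x, D (g x) & injective g; last first.
  exists (fun x y => f (g x) (g y)) => x y x' y'.
  by move=> /(pp_inj (gD _) (gD _) (gD _) (gD _))[/ginj-> /ginj->].
(* The markers [k 0] and [k 1] keep apart the codes of points inside and outside [D], so an
   injection of the complement into [D] gives one of all of [Z] into [D]. *)
suff [e eD einj] : exists2 e : Z -> Z, set_fun (~` D) D e & set_inj (~` D) e.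
  exists (fun x => if `[< D x >] then f (k 0) x else f (k 1) (e x)) => [x|x y].
    case: asboolP => [Dx|nDx]; first exact: pp_closed (kD 0) Dx.
    exact: pp_closed (kD 1) (eD _ nDx).
  case: asboolP => [Dx|nDx]; case: asboolP => [Dy|nDy].
  - by move=> /(pp_inj (kD 0) Dx (kD 0) Dy)[].
  - by move=> /(pp_inj (kD 0) Dx (kD 1) (eD _ nDy))[/kinj].
  - by move=> /(pp_inj (kD 1) (eD _ nDx) (kD 0) Dy)[/kinj].
  - move=> /(pp_inj (kD 1) (eD _ nDx) (kD 1) (eD _ nDy))[_].
    by apply: einj; apply/mem_set.
have [E0|/set0P En0] := eqVneq (~` D) set0.
  by exists id => [x|x y /set_mem]; rewrite E0.
(* An injection of [D] into its complement is excluded by maximality and [pp_extend], so the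
   complement injects into [D]. *)
have [|[i iDE iinj]|//] := set_inj_total (A := D) _ En0; first by exists (k 0).
by have [q /pmax ->] := pp_extend iDE iinj.
Qed.

End Pairing.

Lemma seq_inj_exists (Z : Type) : infinite_set [set: Z] ->
  exists c : seq Z -> Z, injective c.
Proof.
move=> Zinf; have [f fI] := pairing_exists Zinf.
have [h hinj] := (infinite_nat_inj Z).1 Zinf.
(* The fold ends in the arbitrary value [h 0]; pairing with the length tells where the list
   stops. *)
pose code := foldr f (h 0); exists (fun l => f (h (size l)) (code l)) => k l.
move=> /fI[/hinj]; elim: k l => [|x k IHk] [|y l] //= [/IHk{}IHk] /fI[-> /IHk->//].
Qed.

Local Open Scope group_scope.

(** * Subgroups and partial homomorphisms *)

Lemma is_subgroupP (G : groupType) (A : set G) :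
  is_subgroup A <->
  [/\ A 1, forall x y, A x -> A y -> A (x * y) & forall x, A x -> A x^-1].
Proof.
split=> [gA|[A1 AM AV]].
  have [/set_mem A1 _] := gA; split=> // [x y /mem_set Ax /mem_set Ay|x /mem_set Ax].
    exact/set_mem/(group_closedM gA).
  exact/set_mem/(group_closedV gA).
split; first exact: mem_set.
by move=> x y /set_mem Ax /set_mem Ay; apply/mem_set/AM => //; apply: AV.
Qed.

Lemma subgroup1 (G : groupType) (A : set G) : is_subgroup A -> A 1.
Proof. by move=> /is_subgroupP[]. Qed.

Lemma subgroupM (G : groupType) (A : set G) x y :
  is_subgroup A -> A x -> A y -> A (x * y).
Proof. by move=> /is_subgroupP[_ + _]; apply. Qed.

Lemma subgroupV (G : groupType) (A : set G) x : is_subgroup A -> A x -> A x^-1.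
Proof. by move=> /is_subgroupP[_ _]; apply. Qed.

Lemma subgroupT (G : groupType) : is_subgroup [set: G].
Proof. exact/is_subgroupP. Qed.

(** Subgroups are sets in an ambient group, so homomorphisms are total functions that are
    multiplicative on [A] only. *)
Definition hom_on (G H : groupType) (A : set G) (f : G -> H) :=
  forall x y, A x -> A y -> f (x * y) = f x * f y.

Section HomOn.
Variables (G H : groupType) (A : set G) (f : G -> H).
Hypotheses (gA : is_subgroup A) (fM : hom_on A f).

Lemma hom_on1 : f 1 = 1.
Proof.
have A1 := subgroup1 gA.
by apply: (mulgI (f 1)); rewrite mulg1 -fM // mulg1.
Qed.

Lemma hom_onV x : A x -> f x^-1 = (f x)^-1.
Proof.
move=> Ax; have AV := subgroupV gA Ax.
by apply/esym/mulg1_eq; rewrite -fM // mulgV hom_on1.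
Qed.

Lemma hom_on_conj g x : A g -> A x -> f (g * x * g^-1) = f g * f x * (f g)^-1.
Proof.
move=> Ag Ax; have AV := subgroupV gA Ag.
by rewrite fM ?fM ?hom_onV //; apply: subgroupM.
Qed.

Lemma hom_on_image_subgroup B : is_subgroup B -> B `<=` A -> is_subgroup (f @` B).
Proof.
move=> gB BA; apply/is_subgroupP; split.
- by exists 1; [apply: subgroup1|apply: hom_on1].
- move=> _ _ [x Bx <-] [y By <-]; exists (x * y); first exact: subgroupM.
  by rewrite fM //; apply: BA.
- move=> _ [x Bx <-]; exists x^-1; first exact: subgroupV.
  by rewrite hom_onV //; apply: BA.
Qed.

Lemma hom_on_preimage_subgroup B :
  is_subgroup B -> is_subgroup [set x | A x /\ B (f x)].
Proof.
move=> gB; apply/is_subgroupP; split=> [|x y [Ax Bx] [Ay By]|x [Ax Bx]] /=.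
- by rewrite hom_on1; split; apply: subgroup1.
- by rewrite fM //; split; apply: subgroupM.
- by rewrite hom_onV //; split; apply: subgroupV.
Qed.

End HomOn.

Lemma hom_on_comp (G H L : groupType) (A : set G) (B : set H) (f : G -> H)
    (h : H -> L) :
  hom_on A f -> f @` A `<=` B -> hom_on B h -> hom_on A (h \o f).
Proof.
move=> fM fAB hM x y Ax Ay /=.
by rewrite fM // hM //; apply: fAB; [exists x|exists y].
Qed.

Lemma hom_on_sub (G H : groupType) (A B : set G) (f : G -> H) :
  B `<=` A -> hom_on A f -> hom_on B f.
Proof. by move=> BA fM x y Bx By; apply: fM; apply: BA. Qed.

Lemma hom_on_eq (G H : groupType) (A : set G) (f h : G -> H) :
    is_subgroup A -> hom_on A f -> hom_on A h ->
  is_subgroup [set x | A x /\ f x = h x].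
Proof.
move=> gA fM hM; apply/is_subgroupP; split=> [|x y [Ax ex] [Ay ey]|x [Ax ex]] /=.
- by rewrite (hom_on1 gA fM) (hom_on1 gA hM); split=> //; apply: subgroup1.
- by rewrite fM // hM // ex ey; split=> //; apply: subgroupM.
- by rewrite (hom_onV gA fM) // (hom_onV gA hM) // ex; split=> //; apply: subgroupV.
Qed.

Definition conj_by (G : groupType) (g x : G) := g * x * g^-1.

Lemma conj_byM (G : groupType) (g : G) : hom_on [set: G] (conj_by g).
Proof. by move=> x y _ _; rewrite /conj_by !mulgA mulgVK. Qed.

Lemma conj_byK (G : groupType) (g : G) : cancel (conj_by g) (conj_by g^-1).
Proof. by move=> x; rewrite /conj_by invgK !mulgA mulVg mul1g mulgVK. Qed.

Lemma conj_byKV (G : groupType) (g : G) : cancel (conj_by g^-1) (conj_by g).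
Proof. by move=> x; rewrite -{1}[g]invgK conj_byK. Qed.

Lemma conj_by_inj (G : groupType) (g : G) : injective (conj_by g).
Proof. exact: can_inj (conj_byK g). Qed.

Lemma conj_by_stable (G : groupType) (A : set G) g :
  is_subgroup A -> A g -> conj_by g @` A = A.
Proof.
move=> gA Ag; have AV := subgroupV gA Ag.
apply/seteqP; split=> [_ [x Ax <-]|x Ax].
  by apply: subgroupM => //; apply: subgroupM.
exists (conj_by g^-1 x); last exact: conj_byKV.
by apply: subgroupM; rewrite ?invgK //; apply: subgroupM.
Qed.

(** * Groups given by generators and relations *)

Section Words.
Variables (V : Type) (G : groupType) (g : V -> G).

Lemma word_eval_nil : word_eval g [::] = 1.
Proof. exact: big_nil. Qed.

Lemma word_eval_cons x b w :
  word_eval g ((x, b) :: w) = (if b then (g x)^-1 else g x) * word_eval g w.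
Proof. exact: big_cons. Qed.

Lemma word_eval_cat u v : word_eval g (u ++ v) = word_eval g u * word_eval g v.
Proof. exact: big_cat. Qed.

Lemma word_eq_eval (R : set (word V)) w w' :
  (forall r, R r -> word_eval g r = 1) ->
  word_eq R w w' -> word_eval g w = word_eval g w'.
Proof.
move=> gR; elim=> {w w'} // [w w' w'' _ -> _ ->||u v r /gR r1] //.
  move=> u v x b; rewrite !word_eval_cat !word_eval_cons mulgA.
  by case: b; rewrite /= ?mulVg ?mulgV ?mulgA ?mulgVK ?mulgK.
by rewrite !word_eval_cat r1 mul1g.
Qed.

End Words.

Definition word_inv (V : Type) (w : word V) : word V :=
  rev [seq (p.1, ~~ p.2) | p <- w].

Section PresentedGroup.
Variables (V : Type) (R : set (word V)).

Lemma word_eq_cat2 a b u v :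
  word_eq R u v -> word_eq R (a ++ u ++ b) (a ++ v ++ b).
Proof.
elim=> {u v} [w|w w' _ /word_eq_sym //|w w' w'' _ + _|u v x c|u v r Rr].
- exact: word_eq_refl.
- exact: word_eq_trans.
- rewrite -!catA /= !(catA a); exact: word_eq_cancel.
- rewrite -!catA !(catA a); exact: word_eq_relator.
Qed.

Lemma word_eq_cat u v u' v' :
  word_eq R u u' -> word_eq R v v' -> word_eq R (u ++ v) (u' ++ v').
Proof.
move=> /(@word_eq_cat2 [::] v) uu /(@word_eq_cat2 u' [::]).
by rewrite !cats0 /= in uu *; apply: word_eq_trans.
Qed.

Lemma word_eq_invl w : word_eq R (word_inv w ++ w) [::].
Proof.
elim: w => [|[x b] w IHw]; first exact: word_eq_refl.
rewrite /word_inv /= rev_cons -cats1 -catA /=.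
apply: word_eq_trans IHw; rewrite -{2}[b]negbK; exact: word_eq_cancel.
Qed.

Lemma word_invK : involutive (@word_inv V).
Proof.
move=> w; rewrite /word_inv map_rev revK -map_comp -[RHS]map_id.
by apply: eq_map => -[x b] /=; rewrite negbK.
Qed.

Lemma word_eq_invr w : word_eq R (w ++ word_inv w) [::].
Proof. rewrite -{1}[w]word_invK; exact: word_eq_invl. Qed.

(** The representative depends only on the class as a predicate, so by extensionality equivalent
    words get the same one. The presented group is then the type of chosen words, and its equality
    is plain equality. *)
Definition class_rep (P : set (word V)) : word V :=
  if pselect (exists w, P w) is left h then projT1 (cid h) else [::].

Lemma class_repP w : word_eq R w (class_rep (word_eq R w)).
Proof.
rewrite /class_rep; case: pselect => [h|[]]; first exact: (projT2 (cid h)).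
by exists w; apply: word_eq_refl.
Qed.

Lemma class_rep_eq w w' :
  word_eq R w w' -> class_rep (word_eq R w) = class_rep (word_eq R w').
Proof.
move=> ww'; congr class_rep; apply/funext => v; apply/propext; split.
  exact/word_eq_trans/word_eq_sym.
exact/word_eq_trans.
Qed.

Record presented_group :=
  PresentedGroup { pg_val : word V; _ : class_rep (word_eq R pg_val) = pg_val }.

HB.instance Definition _ := gen_eqMixin presented_group.
HB.instance Definition _ := gen_choiceMixin presented_group.

Definition pg_class (w : word V) : presented_group :=
  PresentedGroup (esym (class_rep_eq (class_repP w))).

Lemma pg_valK x : pg_class (pg_val x) = x.
Proof.
case: x => w e; rewrite /pg_class /=.
move: (esym _) => /=; rewrite e => e'; congr PresentedGroup.
exact: Prop_irrelevance.
Qed.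

Lemma pg_classE w w' : pg_class w = pg_class w' <-> word_eq R w w'.
Proof.
split=> [[e]|ww'].
  apply: word_eq_trans (class_repP w) _; rewrite e.
  exact/word_eq_sym/class_repP.
rewrite -[LHS]pg_valK -[RHS]pg_valK; congr pg_class; exact: class_rep_eq.
Qed.

Lemma pg_val_class w : word_eq R (pg_val (pg_class w)) w.
Proof. exact/word_eq_sym/class_repP. Qed.

Definition pg_mul x y := pg_class (pg_val x ++ pg_val y).
Definition pg_inv x := pg_class (word_inv (pg_val x)).

Lemma pg_mulE u v : pg_mul (pg_class u) (pg_class v) = pg_class (u ++ v).
Proof. by apply/pg_classE/word_eq_cat; apply: pg_val_class. Qed.

Lemma pg_mulA : associative pg_mul.
Proof.
move=> x y z; rewrite -[x]pg_valK -[y]pg_valK -[z]pg_valK.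
by rewrite !pg_mulE catA.
Qed.

Lemma pg_mul1 : left_id (pg_class [::]) pg_mul.
Proof. by move=> x; rewrite -[x]pg_valK pg_mulE. Qed.

Lemma pg_mulr1 : right_id (pg_class [::]) pg_mul.
Proof. by move=> x; rewrite -[x]pg_valK pg_mulE cats0. Qed.

Lemma pg_mulV : left_inverse (pg_class [::]) pg_inv pg_mul.
Proof.
move=> x; rewrite -{2}[x]pg_valK pg_mulE; apply/pg_classE; exact: word_eq_invl.
Qed.

Lemma pg_mulrV : right_inverse (pg_class [::]) pg_inv pg_mul.
Proof.
move=> x; rewrite -{1}[x]pg_valK pg_mulE; apply/pg_classE; exact: word_eq_invr.
Qed.

HB.instance Definition _ :=
  isGroup.Build presented_group pg_mulA pg_mul1 pg_mulr1 pg_mulV pg_mulrV.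

Definition pg_gen (x : V) : presented_group := pg_class [:: (x, false)].

Lemma pg_classM u v : pg_class (u ++ v) = pg_class u * pg_class v.
Proof. by rewrite -pg_mulE. Qed.

Lemma word_eval_pg_gen w : word_eval pg_gen w = pg_class w.
Proof.
elim: w => [|[x b] w IHw]; first exact: word_eval_nil.
rewrite word_eval_cons IHw -cat1s pg_classM; congr (_ * _); case: b => //.
apply: mulg1_eq; rewrite -pg_classM; apply/pg_classE.
exact: (@word_eq_cancel _ R [::] [::] x false).
Qed.

(** Von Dyck's theorem: evaluation in [H] is constant on classes, so evaluating the chosen
    representative is multiplicative. *)
Lemma pg_hom (H : groupType) (phi : V -> H) :
  (forall r, R r -> word_eval phi r = 1) ->
  exists2 F : presented_group -> H,
    hom_on [set: presented_group] F & forall x, F (pg_gen x) = phi x.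
Proof.
move=> phiR; exists (word_eval phi \o pg_val) => [x y _ _|x] /=.
  by rewrite -word_eval_cat; apply: word_eq_eval (pg_val_class _).
rewrite (word_eq_eval phiR (pg_val_class _)).
by rewrite word_eval_cons word_eval_nil mulg1.
Qed.

End PresentedGroup.

(** * Coxeter bases through their universal property *)

(** For involutions, the square of [s t] is trivial exactly when [s] and [t] commute. *)
Lemma right_angled_relators_eval (V : Type) (E : V -> V -> Prop) (H : groupType)
    (phi : V -> H) :
  (forall r, right_angled_relators E r -> word_eval phi r = 1) <->
  (forall s, phi s * phi s = 1) /\
  (forall s t, s <> t -> E s t -> phi s * phi t = phi t * phi s).
Proof.
split=> [phiR|[phi2 phiC] r].
  have phi2 s : phi s * phi s = 1.
    rewrite -(phiR [:: (s, false); (s, false)]); last by left; exists s.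
    by rewrite !word_eval_cons word_eval_nil mulg1.
  split=> // s t st Est.
  have : word_eval phi [:: (s, false); (t, false); (s, false); (t, false)] = 1.
    by apply: phiR; right; exists s, t.
  rewrite !word_eval_cons word_eval_nil mulg1 mulgA => /mulg1_eq <-.
  by rewrite invgM (mulg1_eq (phi2 s)) (mulg1_eq (phi2 t)).
move=> [[s ->]|[s [t [st Est ->]]]]; rewrite !word_eval_cons word_eval_nil mulg1 //.
by rewrite [phi s * phi t]phiC // [phi t * (_ * _)]mulgA phi2 mul1g.
Qed.

Definition generates (G : groupType) (A S : set G) :=
  forall B, is_subgroup B -> S `<=` B -> A `<=` B.

(** Commutation is tested in [G] itself, so that the relation [E] of a presentation no longer
    appears. *)
Definition respects (G H : groupType) (S : set G) (phi : G -> H) :=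
  (forall s, S s -> phi s * phi s = 1) /\
  (forall s t, S s -> S t -> s * t = t * s -> phi s * phi t = phi t * phi s).

Definition extendable (G : groupType) (A S : set G) :=
  forall (H : groupType) (phi : G -> H), respects S phi ->
  exists2 F : G -> H, hom_on A F & {in S, F =1 phi}.

Definition graph_group (Gamma : graph) : groupType :=
  presented_group (right_angled_relators (@adj Gamma)).

Definition graph_gen (Gamma : graph) : Gamma -> graph_group Gamma :=
  @pg_gen _ (right_angled_relators (@adj Gamma)).

Section GraphGroup.
Variable Gamma : graph.
Notation gen := (@graph_gen Gamma).

Lemma graph_gen_relations :
  (forall s, gen s * gen s = 1) /\
  (forall s t, s <> t -> adj s t -> gen s * gen t = gen t * gen s).
Proof.
apply/right_angled_relators_eval => r Rr; rewrite word_eval_pg_gen.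
by apply/pg_classE; have := word_eq_relator [::] [::] Rr; rewrite cats0.
Qed.

Lemma graph_gen_invol s : gen s * gen s = 1.
Proof. exact: graph_gen_relations.1. Qed.

Lemma graph_gen_adj s t : adj s t -> gen s * gen t = gen t * gen s.
Proof.
move=> st; apply: graph_gen_relations.2 => // e.
by rewrite e in st; apply: adj_irr st.
Qed.

Lemma graph_group_hom (H : groupType) (phi : Gamma -> H) :
  (forall s, phi s * phi s = 1) ->
  (forall s t, adj s t -> phi s * phi t = phi t * phi s) ->
  exists2 F : graph_group Gamma -> H,
    hom_on [set: graph_group Gamma] F & forall s, F (gen s) = phi s.
Proof.
move=> phi2 phiC; apply: pg_hom; apply/right_angled_relators_eval.
by split=> // s t _; apply: phiC.
Qed.

End GraphGroup.

Lemma word_eval_subgroup (V : Type) (G : groupType) (g : V -> G) (B : set G) :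
  is_subgroup B -> (forall x, B (g x)) -> forall w, B (word_eval g w).
Proof.
move=> gB Bg; elim=> [|[x b] w IHw]; first by rewrite word_eval_nil; apply: subgroup1.
rewrite word_eval_cons; apply: subgroupM => //.
by case: b => //; apply: subgroupV.
Qed.

Lemma range_word_eval_subgroup (V : Type) (G : groupType) (g : V -> G) :
  is_subgroup (range (word_eval g)).
Proof.
have VE w : word_eval g (word_inv w) = (word_eval g w)^-1.
  apply/esym/mulg1_eq; rewrite -word_eval_cat.
  rewrite (@word_eq_eval _ _ g set0 _ [::]) ?word_eval_nil //.
  exact: word_eq_invr.
apply/is_subgroupP; split=> [|_ _ [u _ <-] [v _ <-]|_ [w _ <-]].
- by exists [::] => //; apply: word_eval_nil.
- by exists (u ++ v) => //; apply: word_eval_cat.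
- by exists (word_inv w).
Qed.

Lemma hom_on_word_eval (V : Type) (G H : groupType) (A : set G) (g : V -> G)
    (f : G -> H) (w : word V) :
  is_subgroup A -> (forall x, A (g x)) -> hom_on A f ->
  f (word_eval g w) = word_eval (f \o g) w.
Proof.
move=> gA Ag fM; elim: w => [|[x b] w IHw].
  by rewrite !word_eval_nil (hom_on1 gA fM).
have Aw := word_eval_subgroup gA Ag w.
rewrite !word_eval_cons fM // ?IHw; last by case: b => //; apply: subgroupV.
by case: b => //; rewrite (hom_onV gA fM).
Qed.

(** From a presentation, a map on [S] is extended by evaluating words. Conversely, take the
    commutation graph as [E] and extend the map from [S] to the group presented by that graph: the
    extension recovers the class of a word from its value. *)
Lemma coxeter_basisP (G : groupType) (A S : set G) :
  coxeter_basis A S <->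
  [/\ is_subgroup A, S `<=` A, forall s, S s -> s * s = 1,
      generates A S & extendable A S].
Proof.
split=> [[E [defA evalE]]|[gA SA S2 genA extA]].
  have evalR r : right_angled_relators E r -> word_eval (fun s : S => val s) r = 1.
    move=> Rr; rewrite -(word_eval_nil (fun s : S => val s)); apply/evalE.
    by have := word_eq_relator [::] [::] Rr; rewrite cats0.
  have [S2 SC] := (right_angled_relators_eval _ _).1 evalR.
  have SA s : S s -> A s.
    move=> Ss; rewrite -defA; exists [:: (SigSub (mem_set Ss), false)] => //.
    by rewrite word_eval_cons word_eval_nil mulg1.
  split=> // [|s Ss||].
  - by rewrite -defA; apply: range_word_eval_subgroup.
  - exact: (S2 (SigSub (mem_set Ss))).
  - move=> B gB SB; rewrite -defA => _ [w _ <-].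
    by apply: word_eval_subgroup => // s; apply/SB/set_mem/valP.
  move=> H phi [phi2 phiC].
  have phiR r : right_angled_relators E r ->
      word_eval (fun s : S => phi (val s)) r = 1.
    move: r; apply/right_angled_relators_eval; split=> [s|s t st Est].
      exact/phi2/set_mem/valP.
    by apply: phiC; [apply/set_mem/valP|apply/set_mem/valP|apply: SC].
  have /choice[rep repE] : forall a, exists w,
      A a -> word_eval (fun s : S => val s) w = a.
    move=> a; have [Aa|nAa] := pselect (A a); last by exists [::].
    by move: (Aa); rewrite -defA => -[w _ <-]; exists w.
  (* [rep] picks a word for each element of [A]; [FE] shows that any other word with the same value
     gives the same result. *)
  pose F a := word_eval (fun s : S => phi (val s)) (rep a).
  have FE w : F (word_eval (fun s : S => val s) w) =
              word_eval (fun s : S => phi (val s)) w.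
    apply: (word_eq_eval phiR); apply/evalE; apply: repE.
    by rewrite -defA; exists w.
  exists F => [x y|s /set_mem Ss].
    rewrite -{1 2}defA => -[u _ <-] [v _ <-].
    by rewrite -word_eval_cat !FE word_eval_cat.
  have := FE [:: (SigSub (mem_set Ss), false)].
  by rewrite !word_eval_cons !word_eval_nil !mulg1.
exists (@coxeter_adj G S).
have Sval (s : S) : S (val s) by apply/set_mem/valP.
have evalR r : right_angled_relators (@coxeter_adj G S) r ->
    word_eval (fun s : S => val s) r = 1.
  by move: r; apply/right_angled_relators_eval; split=> [s|s t _ []//]; apply: S2.
split.
  apply/seteqP; split=> [_ [w _ <-]|].
    by apply: word_eval_subgroup => // s; apply: SA.
  apply: genA; first exact: range_word_eval_subgroup.
  move=> s Ss; exists [:: (SigSub (mem_set Ss), false)] => //.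
  by rewrite word_eval_cons word_eval_nil mulg1.
pose phi x : graph_group (coxeter_graph S) :=
  if pselect (S x) is left h then @graph_gen (coxeter_graph S) (SigSub (mem_set h))
  else 1.
have phiE (s : S) : phi (val s) = @graph_gen (coxeter_graph S) s.
  rewrite /phi; case: pselect => [h|]; last by have := Sval s.
  by congr (@graph_gen (coxeter_graph S) _); apply: val_inj.
have [|F FM Fphi] := extA _ phi.
  split=> [s Ss|s t Ss St st].
    by rewrite (phiE (SigSub (mem_set Ss))) graph_gen_invol.
  have [->//|nst] := pselect (s = t).
  rewrite (phiE (SigSub (mem_set Ss))) (phiE (SigSub (mem_set St))).
  by apply: graph_gen_adj; split=> // -[].
(* [F] is a left inverse of evaluation, modulo equivalence of words. *)
have FE w : F (word_eval (fun s : S => val s) w) =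
            pg_class (right_angled_relators (@coxeter_adj G S)) w.
  rewrite (hom_on_word_eval w gA _ FM) => [|s]; last exact: SA.
  rewrite -word_eval_pg_gen.
  suff -> : F \o (fun s : S => val s) = @graph_gen (coxeter_graph S) by [].
  by apply/funext => s; rewrite -phiE; apply: Fphi; exact/mem_set.
move=> w w'; split=> [e|]; last exact: word_eq_eval.
by apply/pg_classE; rewrite -!FE e.
Qed.

(** A test group, the symmetric group on three points, used to show generators nontrivial, distinct
    or noncommuting. *)
Lemma noncommuting_involutions :
  exists (H : groupType) (a b : H), [/\ a * a = 1, b * b = 1 & a * b <> b * a].
Proof.
pose a : 'S_3 := tperm ord0 (lift ord0 ord0).
pose b : 'S_3 := tperm (lift ord0 ord0) ord_max.
exists 'S_3, a, b; split; [exact: tperm2|exact: tperm2|].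
move=> /permP /(_ ord0); rewrite !permM tpermL.
by rewrite [b ord0]tpermD // !tpermL.
Qed.

Section Basis.
Variables (G : groupType) (A S : set G).
Hypothesis bA : coxeter_basis A S.

Lemma basis_subgroup : is_subgroup A.
Proof. by have [] := (coxeter_basisP A S).1 bA. Qed.

Lemma basis_sub : S `<=` A.
Proof. by have [] := (coxeter_basisP A S).1 bA. Qed.

Lemma basis_invol s : S s -> s * s = 1.
Proof. by have [_ _ + _ _] := (coxeter_basisP A S).1 bA; apply. Qed.

Lemma basis_gen : generates A S.
Proof. by have [] := (coxeter_basisP A S).1 bA. Qed.

Lemma basis_ext : extendable A S.
Proof. by have [] := (coxeter_basisP A S).1 bA. Qed.

Lemma basis_hom_eq (H : groupType) (f h : G -> H) :
  hom_on A f -> hom_on A h -> (forall s, S s -> f s = h s) ->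
  forall x, A x -> f x = h x.
Proof.
move=> fM hM fh x Ax.
have [] : (A `&` [set x | f x = h x]) x; last by [].
apply: basis_gen Ax; first exact: (hom_on_eq basis_subgroup fM hM).
by move=> s Ss; split; [apply: basis_sub|apply: fh].
Qed.

(** The relations survive because 1 squares to 1 and commutes with everything. *)
Lemma basis_retraction X : X `<=` S ->
  exists rho : G -> G, [/\ hom_on A rho, forall s, X s -> rho s = s
    & forall s, S s -> ~ X s -> rho s = 1].
Proof.
move=> XS.
have [|rho rhoM rhoE] := basis_ext (phi := fun x => if `[< X x >] then x else 1).
  split=> [s Ss|s t Ss St st].
    by case: asboolP => _; rewrite ?mulg1 //; apply: basis_invol.
  by case: asboolP => _; case: asboolP => _; rewrite ?mulg1 ?mul1g.
exists rho; split=> // [s Xs|s Ss nXs].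
  by rewrite rhoE; [rewrite asboolT|apply/mem_set/XS].
by rewrite rhoE; [rewrite asboolF|apply/mem_set].
Qed.

(** Sending every generator to the same involution [a] respects the relations; if [s] were 1, then
    [a] would be 1. *)
Lemma basis_neq1 s : S s -> s <> 1.
Proof.
move=> Ss s1; have [H [a [b [a2 b2 ab]]]] := noncommuting_involutions.
have [|F FM FE] := basis_ext (phi := fun=> a); first by split.
apply: ab; rewrite -(FE s) ?s1; last by rewrite -s1; apply/mem_set.
by rewrite (hom_on1 basis_subgroup FM) mulg1 mul1g.
Qed.

(** No inverses occur in the product: generators being involutions, a product is inverted by
    reversing it. *)
Lemma basis_prod x : A x ->
  exists2 l : seq G, (forall s, s \in l -> S s) & x = \prod_(s <- l) s.
Proof.
pose P := [set \prod_(s <- l) s | l in [set l : seq G | forall s, s \in l -> S s]].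
suff AP : A `<=` P by move=> /AP[l Sl <-]; exists l.
apply: basis_gen; last first.
  by move=> s Ss; exists [:: s]; rewrite /= ?big_seq1 // => t; rewrite inE => /eqP->.
apply/is_subgroupP; split=> [|_ _ [k Sk <-] [l Sl <-]|_ [l Sl <-]].
- by exists [::]; rewrite /= ?big_nil.
- exists (k ++ l); last by rewrite big_cat.
  by move=> s; rewrite mem_cat => /orP[/Sk|/Sl].
exists (rev l); first by move=> s; rewrite mem_rev => /Sl.
elim: l Sl => [|s l IHl] Sl; first by rewrite !big_nil invg1.
rewrite rev_cons -cats1 big_cat /= big_seq1 big_cons invgM IHl; last first.
  by move=> t tl; apply: Sl; rewrite inE tl orbT.
congr (_ * _); apply/esym/mulg1_eq/basis_invol/Sl; exact: mem_head.
Qed.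

End Basis.

(** * Subgroups spanned by part of a basis, and transport of bases *)

Definition subgroup_span (G : groupType) (X : set G) : set G :=
  [set x | forall B, is_subgroup B -> X `<=` B -> B x].

Lemma span_subgroup (G : groupType) (X : set G) : is_subgroup (subgroup_span X).
Proof.
apply/is_subgroupP; split=> [B gB _|x y Bx By B gB XB|x Bx B gB XB].
- exact: subgroup1.
- by apply: subgroupM; [|apply: Bx|apply: By].
- by apply: subgroupV => //; apply: Bx.
Qed.

(** A map on [X] that respects the relations still does so when extended by 1 to [S], so it extends
    to [A], hence to the span. *)
Lemma basis_span (G : groupType) (A S X : set G) :
  coxeter_basis A S -> X `<=` S -> coxeter_basis (subgroup_span X) X.
Proof.
move=> bA XS; apply/coxeter_basisP; split.
- exact: span_subgroup.
- by move=> x Xx B _; apply.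
- by move=> s /XS; apply: (basis_invol bA).
- by move=> B gB XB x; apply.
move=> H phi [phi2 phiC].
have [|F FM FE] := basis_ext bA (phi := fun x => if `[< X x >] then phi x else 1).
  split=> [s Ss|s t Ss St st].
    by case: asboolP => ?; rewrite ?mulg1 //; apply: phi2.
  by case: asboolP => ?; case: asboolP => ?; rewrite ?mulg1 ?mul1g //; apply: phiC.
exists F => [|s /set_mem Xs]; last first.
  by rewrite FE; [rewrite asboolT|apply/mem_set/XS].
apply: hom_on_sub FM => x Xx; apply: Xx; first exact: basis_subgroup bA.
exact: subset_trans XS (basis_sub bA).
Qed.

(** The retraction that kills [S] outside [X] fixes [B] pointwise, so an element of [S] in [B] but
    not in [X] would be 1. *)
Lemma basis_meet (G : groupType) (A B S X : set G) :
  coxeter_basis A S -> coxeter_basis B X -> X `<=` S -> B `&` S = X.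
Proof.
move=> bA bB XS; apply/seteqP; split=> [s [Bs Ss]|s Xs]; last first.
  by split; [apply: (basis_sub bB)|apply: XS].
have [rho [rhoM rhoX rho1]] := basis_retraction bA XS.
apply: contrapT => nXs; apply: (basis_neq1 bA Ss).
have BA : B `<=` A.
  apply: (basis_gen bB); first exact: basis_subgroup bA.
  exact: subset_trans XS (basis_sub bA).
rewrite -(rho1 _ Ss nXs).
by apply/esym/(basis_hom_eq bB (h := id) _ _ rhoX) => //; apply: hom_on_sub rhoM.
Qed.

Lemma group_isomP (G H : groupType) (A : set G) (B : set H) f :
  group_isom A B f <-> [/\ is_subgroup A, hom_on A f, set_inj A f & f @` A = B].
Proof.
split=> [[gA gB [fAB finj fsurj] fM]|[gA fM finj <-]].
  by split=> //; apply/seteqP; split=> // _ [x Ax <-]; apply: fAB.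
split=> //; first exact: (hom_on_image_subgroup gA fM).
by split=> // x Ax; exists x.
Qed.

Lemma basis_image (G H : groupType) (A S : set G) (f : G -> H) :
  hom_on A f -> set_inj A f -> coxeter_basis A S ->
  coxeter_basis (f @` A) (f @` S).
Proof.
move=> fM finj bA; have gA := basis_subgroup bA; have SA := basis_sub bA.
apply/coxeter_basisP; split.
- exact: (hom_on_image_subgroup gA fM).
- exact: image_subset.
- move=> _ [s Ss <-]; rewrite -fM; [|exact: SA..].
  by rewrite (basis_invol bA) // (hom_on1 gA fM).
- move=> B gB SB _ [x Ax <-].
  suff [] : [set x | A x /\ B (f x)] x by [].
  apply: (basis_gen bA) Ax => [|s Ss]; first exact: hom_on_preimage_subgroup.
  by split; [apply: SA|apply: SB; exists s].
move=> L phi [phi2 phiC].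
have [|F FM FE] := basis_ext bA (phi := phi \o f).
  split=> [s Ss|s t Ss St st] /=; first by apply: phi2; exists s.
  by apply: phiC; [exists s|exists t|rewrite -!fM ?st //; apply: SA].
(* [h] inverts [f] on the image of [A], with default value 1 elsewhere. *)
have /choice[h hE] : forall y, exists x, (f @` A) y -> A x /\ f x = y.
  move=> y; have [[x Ax <-]|ny] := pselect ((f @` A) y); first by exists x.
  by exists 1.
have hf x : A x -> h (f x) = x.
  move=> Ax; have [|Ahx fhx] := hE (f x); first by exists x.
  by apply: finj => //; apply/mem_set.
exists (F \o h) => [_ _ [x Ax <-] [y Ay <-]|_ /set_mem[s Ss <-]] /=.
  by rewrite -fM // !hf ?FM //; apply: subgroupM.
by rewrite hf; [apply/FE/mem_set|apply: SA].
Qed.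

Lemma basis_conj (G : groupType) (A S : set G) g :
  coxeter_basis A S -> coxeter_basis (conj_by g @` A) (conj_by g @` S).
Proof.
apply: basis_image; first exact: hom_on_sub (@conj_byM _ g).
by move=> x y _ _; apply: conj_by_inj.
Qed.

Lemma basis_conj_in (G : groupType) (A S : set G) g :
  coxeter_basis A S -> A g -> coxeter_basis A (conj_by g @` S).
Proof.
move=> bA Ag; have := basis_conj g bA.
by rewrite conj_by_stable //; apply: basis_subgroup bA.
Qed.

Lemma conj_by_setI (G : groupType) (A B : set G) g :
  conj_by g @` (A `&` B) = conj_by g @` A `&` conj_by g @` B.
Proof.
apply/seteqP; split=> [_ [x [Ax Bx] <-]|_ [[x Ax <-] [y By]]].
  by split; exists x.
by move=> /conj_by_inj yx; exists x => //; split=> //; rewrite -yx.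
Qed.

(* The induced homomorphism is injective because it has a left inverse, killing
   the generators outside the image of [S]. *)
Lemma basis_embedding (G H : groupType) (A S : set G) (B T : set H) (f : G -> H) :
  coxeter_basis A S -> coxeter_basis B T -> set_inj S f -> f @` S `<=` T ->
  (forall s t, S s -> S t -> (s * t = t * s <-> f s * f t = f t * f s)) ->
  exists F : G -> H, [/\ group_isom A (F @` A) F, special_subgroup (F @` A) B
    & forall s, S s -> F s = f s].
Proof.
move=> bA bB finj fST fC; have gA := basis_subgroup bA; have gB := basis_subgroup bB.
have [|F FM FE] := basis_ext bA (phi := f).
  split=> [s Ss|s t Ss St]; last by move/fC; apply.
  by apply: (basis_invol bB); apply: fST; exists s.
have {}FE s : S s -> F s = f s by move=> /mem_set; apply: FE.
(* [h] inverts [f] on the image of [S]; the value 1 elsewhere kills the other generators, and [K]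
   below extends it to [B]. *)
have /choice[h hE] : forall y, exists x,
    ((f @` S) y -> S x /\ f x = y) /\ (~ (f @` S) y -> x = 1).
  move=> y; have [[x Sx <-]|ny] := pselect ((f @` S) y); last by exists 1.
  by exists x; split=> // -[]; exists x.
have hf s : S s -> h (f s) = s.
  move=> Ss; have [Shs fhs] := (hE (f s)).1 (imageP f Ss).
  by apply: finj => //; apply/mem_set.
have [|K KM KE] := basis_ext bB (phi := h).
  have h2 t : T t -> h t * h t = 1.
    have [[s Ss <-]|nt] := pselect ((f @` S) t); last by rewrite (hE t).2 ?mulg1.
    by rewrite hf // (basis_invol bA).
  split=> // s t Ts Tt st.
  have [[s' Ss' es]|ns] := pselect ((f @` S) s); last by rewrite (hE s).2 ?mulg1 ?mul1g.
  have [[t' St' et]|nt] := pselect ((f @` S) t); last by rewrite (hE t).2 ?mulg1 ?mul1g.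
  by move: st; rewrite -es -et !hf // => /fC; apply.
have FAB : F @` A `<=` B.
  move=> _ [x Ax <-]; suff [] : [set x | A x /\ B (F x)] x by [].
  apply: (basis_gen bA) Ax => [|s Ss]; first exact: hom_on_preimage_subgroup.
  split; first exact: basis_sub bA _ Ss.
  by rewrite FE //; apply/(basis_sub bB)/fST; exists s.
have KF : forall x, A x -> K (F x) = x.
  apply: (basis_hom_eq bA (f := K \o F) (h := id)) => // [|s Ss /=].
    exact: hom_on_comp FM FAB KM.
  by rewrite FE // KE ?hf //; apply/mem_set/fST; exists s.
have Finj : set_inj A F.
  by move=> x y /set_mem Ax /set_mem Ay e; rewrite -[x]KF // -[y]KF // e.
have FS : F @` S = f @` S by apply: eq_imagel.
have bF : coxeter_basis (F @` A) (f @` S) by rewrite -FS; apply: basis_image.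
exists F; split=> //; first exact/group_isomP.
split; first by split=> //; apply: basis_subgroup bF.
by exists T => //; rewrite (basis_meet bB bF).
Qed.

(* With [rho] the retraction onto [B], any [s] of [g B g^-1] equals its image
   under the retraction onto [g B g^-1], that is [h (rho s) h^-1] with
   [h = g (rho g)^-1]. *)
Lemma basis_conj_meet (G : groupType) (C S B X : set G) (g : G) :
  coxeter_basis C S -> coxeter_basis B X -> X `<=` S -> C g ->
  exists2 b, B b & forall s, S s -> (conj_by g @` B) s ->
    X s /\ conj_by (g * b^-1) s = s.
Proof.
move=> bC bB XS Cg; have gC := basis_subgroup bC; have gB := basis_subgroup bB.
have BC : B `<=` C.
  by apply: (basis_gen bB gC); apply: subset_trans XS (basis_sub bC).
have [rho [rhoM rhoX rho1]] := basis_retraction bC XS.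
have rhoB : forall x, B x -> rho x = x.
  by apply: (basis_hom_eq bB (h := id)) => //; apply: hom_on_sub rhoM.
have rhoC x : C x -> B (rho x).
  move=> Cx; suff [] : [set x | C x /\ B (rho x)] x by [].
  apply: (basis_gen bC) Cx => [|s Ss]; first exact: hom_on_preimage_subgroup.
  split; first exact: basis_sub bC _ Ss.
  have [Xs|nXs] := pselect (X s); first by rewrite rhoX //; apply: (basis_sub bB).
  by rewrite rho1 //; apply: subgroup1.
exists (rho g); first exact: rhoC.
move=> s Ss [x Bx e]; have Cs := basis_sub bC Ss; have CV := subgroupV gC Cg.
have e' : s = conj_by (g * (rho g)^-1) (rho s).
  have -> : rho s = conj_by (rho g) x.
    by rewrite -e (hom_on_conj gC rhoM Cg (BC _ Bx)) (rhoB _ Bx).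
  by rewrite -e /conj_by invgM !mulgA !invgK !mulgVK.
(* Outside [X] the retraction would give [rho s = 1], hence [s = 1]. *)
have Xs : X s.
  apply: contrapT => nXs; apply: (basis_neq1 bC Ss).
  by rewrite e' (rho1 s) // /conj_by mulg1 mulgV.
by split=> //; rewrite {2}e' (rhoX s).
Qed.

(** * The right-angled Coxeter group of a graph *)

Lemma graph_group_basis (Gamma : graph) :
  coxeter_basis [set: graph_group Gamma] (range (@graph_gen Gamma)).
Proof.
apply/coxeter_basisP; split.
- exact: subgroupT.
- by [].
- by move=> _ [x _ <-]; apply: graph_gen_invol.
- move=> B gB SB x _; rewrite -[x]pg_valK -word_eval_pg_gen.
  by apply: word_eval_subgroup => // v; apply: SB; exists v.
move=> H phi [phi2 phiC].
have [|s t st|F FM FE] := @graph_group_hom Gamma H (phi \o @graph_gen Gamma).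
- by move=> s; apply: phi2; exists s.
- by apply: phiC; [exists s|exists t|apply: graph_gen_adj].
by exists F => // _ /set_mem[v _ <-]; apply: FE.
Qed.

(** The homomorphism sending [s] to a nontrivial involution and all other generators to 1 separates
    [s] from them. *)
Lemma graph_gen_inj (Gamma : graph) : injective (@graph_gen Gamma).
Proof.
move=> s t st; apply: contrapT => nst.
have [H [a [b [a2 b2 ab]]]] := noncommuting_involutions.
have [||F FM FE] := @graph_group_hom Gamma H (fun x => if `[< x = s >] then a else 1).
- by move=> x; case: asboolP; rewrite ?mulg1.
- by move=> x y _; case: asboolP; case: asboolP; rewrite ?mulg1 ?mul1g.
have := FE t; rewrite -st FE asboolT // asboolF => [a1|ts]; last exact: nst.
by apply: ab; rewrite a1 mulg1 mul1g.
Qed.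

(** If [s] and [t] are not adjacent, sending them to noncommuting involutions and all other
    generators to 1 respects the relations. *)
Lemma graph_gen_commute (Gamma : graph) (s t : Gamma) : s <> t ->
  graph_gen s * graph_gen t = graph_gen t * graph_gen s -> adj s t.
Proof.
move=> nst st; apply: contrapT => nadj.
have [H [a [b [a2 b2 ab]]]] := noncommuting_involutions.
have [||F FM FE] := @graph_group_hom Gamma H
    (fun x => if `[< x = s >] then a else if `[< x = t >] then b else 1).
- by move=> x; case: asboolP => _; last case: asboolP => _; rewrite ?mulg1.
- move=> x y xy.
  case: asboolP => [xs|_]; case: asboolP => [ys|_]; try case: asboolP => [?|_];
    try case: asboolP => [?|_]; rewrite ?mulg1 ?mul1g //.
  + by exfalso; apply: nadj; subst.
  + by exfalso; apply: nadj; subst; apply: adj_sym.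
apply: ab; have [es et] := (FE s, FE t).
rewrite asboolT // in es; rewrite asboolF ?asboolT // in et; last by move/esym.
by rewrite -es -et -!FM // st.
Qed.

Lemma graph_gen_adjP (Gamma : graph) (s t : Gamma) :
  adj s t <-> graph_gen s <> graph_gen t /\
              graph_gen s * graph_gen t = graph_gen t * graph_gen s.
Proof.
split=> [st|[nst]]; last by apply: graph_gen_commute => e; apply: nst; rewrite e.
split; last exact: graph_gen_adj.
by move=> /graph_gen_inj e; move: st; rewrite e; apply: adj_irr.
Qed.

(** Each element of [A] is a product of a finite list over [Y], and finite lists over the infinite
    [Z] inject into [Z]. *)
Lemma card_generated_le (G : groupType) (A Y : set G) (Z : Type) :
  infinite_set [set: Z] -> coxeter_basis A Y -> Y #<= [set: Z] ->
  A #<= [set: Z].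
Proof.
move=> Zinf bA /card_le_exists[u uinj]; have [c cinj] := seq_inj_exists Zinf.
(* [d] decodes [u], with default value 1, so that lists over [Z] denote products. *)
have /choice[d dE] : forall z : Z, exists g, forall s : Y, val (u s) = z -> val s = g.
  move=> z; have [[s us]|nz] := pselect (exists s : Y, val (u s) = z).
    exists (val s) => t; rewrite -us => /val_inj/uinj -> //.
  by exists 1 => s us; case: nz; exists s.
have : A `<=` range (fun l : seq Z => \prod_(z <- l) d z).
  move=> x /(basis_prod bA)[l Yl ->]; elim: l Yl => [|s l IHl] Yl.
    by exists [::] => //; rewrite !big_nil.
  have [|l' _ l'E] := IHl; first by move=> t tl; apply: Yl; rewrite inE tl orbT.
  have Ys : Y s by apply: Yl; rewrite mem_head.
  exists (val (u (SigSub (mem_set Ys))) :: l') => //.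
  by rewrite !big_cons l'E -(dE _ (SigSub (mem_set Ys)) erefl).
move=> /subset_card_le/card_le_trans; apply.
apply: card_le_trans (card_image_le _ _) _.
by apply: (card_le_inj (f := c)) => // x y _ _; apply: cinj.
Qed.

(** * Coxeter graphs *)

(** Realises the vertices of both graphs in a common type [T], so that graphs on different subtypes
    are compared without writing a bijection by hand. *)
Lemma isomorphic_graphs_via (T : Type) (Gamma Delta : graph)
    (a : Gamma -> T) (b : Delta -> T) :
  injective a -> injective b -> range a = range b ->
  (forall x y x' y', a x = b x' -> a y = b y' -> (adj x y <-> adj x' y')) ->
  isomorphic_graphs Gamma Delta.
Proof.
move=> ainj binj ab adjE.
have /choice[f fE] : forall x, exists y, b y = a x.
  move=> x; have [y _ <-] : range b (a x) by rewrite -ab; exists x.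
  by exists y.
exists f; split=> [|x y _ _]; last by apply: adjE.
split=> [//|x y _ _ fxy|y _]; first by apply: ainj; rewrite -!fE fxy.
have [x _ xy] : range a (b y) by rewrite ab; exists y.
by exists x => //; apply: binj; rewrite fE.
Qed.

Lemma isomorphic_graphs_sym (Gamma Delta : graph) :
  isomorphic_graphs Gamma Delta -> isomorphic_graphs Delta Gamma.
Proof.
move=> [f [[_ finj fsurj] fadj]].
apply: (@isomorphic_graphs_via _ _ _ id f) => //.
- by move=> x y; apply: finj; apply/mem_set.
- by apply/seteqP; split=> // y _; have [x _ <-] := fsurj y I; exists x.
- by move=> x y x' y' -> ->; apply: iff_sym; apply: fadj.
Qed.

Lemma set_val_in (T : Type) (A : set T) (x : A) : A (val x).
Proof. exact/set_mem/valP. Qed.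

Lemma range_val (T : Type) (A : set T) : range (fun x : A => val x) = A.
Proof.
apply/seteqP; split=> [_ [x _ <-]|x Ax]; first exact: set_val_in.
by exists (SigSub (mem_set Ax)).
Qed.

Lemma induced_setT (Gamma : graph) :
  isomorphic_graphs (induced [set: Gamma]) Gamma.
Proof.
apply: (@isomorphic_graphs_via Gamma (induced [set: Gamma]) Gamma
  (fun x : [set: Gamma] => val x) id) => [|||x y _ _ <- <-] //.
by apply/seteqP; split=> // x _; exists (SigSub (mem_set (I : [set: Gamma] x))).
Qed.

Lemma coxeter_graph_image (G H : groupType) (A S : set G) (f : G -> H) :
  is_subgroup A -> hom_on A f -> set_inj A f -> S `<=` A ->
  isomorphic_graphs (coxeter_graph S) (coxeter_graph (f @` S)).
Proof.
move=> gA fM finj SA.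
have fval (x y : S) : f (val x) = f (val y) -> x = y.
  move=> e; apply: val_inj; apply: finj => //.
    by apply/mem_set; apply: SA; apply: set_val_in.
  by apply/mem_set; apply: SA; apply: set_val_in.
apply: (@isomorphic_graphs_via H (coxeter_graph S) (coxeter_graph (f @` S))
  (fun s : S => f (val s)) (fun s : f @` S => val s)) => //.
- by rewrite range_val -[in RHS](range_val S) -image_comp.
move=> x y x' y' ex ey; rewrite /= /coxeter_adj.
have [Ax Ay] : A (val x) /\ A (val y) by split; apply: SA; apply: set_val_in.
rewrite -ex -ey -!fM //; split=> -[nxy e].
  split; last by rewrite e.
  by move=> xy; apply: nxy; apply: fval; rewrite ex ey xy.
split; first by move=> xy; apply: nxy; apply: val_inj; rewrite -ex -ey xy.
by apply: finj => //; apply/mem_set; apply: subgroupM.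
Qed.

Lemma graph_group_graph (Gamma : graph) :
  isomorphic_graphs Gamma (coxeter_graph (range (@graph_gen Gamma))).
Proof.
apply: (@isomorphic_graphs_via _ _ (coxeter_graph _) (@graph_gen Gamma)
  (fun s : range _ => val s)) => //.
- exact: graph_gen_inj.
- by rewrite range_val.
move=> x y x' y' ex ey; rewrite /= /coxeter_adj -ex -ey; split=> [xy|[nxy e]].
  split; last exact: graph_gen_adj.
  move=> e; have {}e : x = y by apply: graph_gen_inj; rewrite ex ey e.
  by move: xy; rewrite e; apply: adj_irr.
apply: graph_gen_commute => // xy; apply: nxy; apply: val_inj.
by rewrite -ex -ey xy.
Qed.

(** * Unions of chains *)

(** For a directed union, the homomorphisms that extend [phi] on the pieces agree on overlaps,
    because each is determined by its values on the basis; hence they glue. *)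
Lemma basis_bigcup (J : Type) (D : set J) (G : groupType) (A S : J -> set G) :
  D !=set0 ->
  (forall i j, D i -> D j -> exists k,
     [/\ D k, A i `<=` A k, A j `<=` A k, S i `<=` S k & S j `<=` S k]) ->
  (forall i, D i -> coxeter_basis (A i) (S i)) ->
  coxeter_basis (\bigcup_(i in D) A i) (\bigcup_(i in D) S i).
Proof.
move=> [i0 Di0] dir bA; apply/coxeter_basisP; split.
- apply/is_subgroupP; split=> [|x y [i Di Ax] [j Dj Ay]|x [i Di Ax]].
  + by exists i0 => //; apply: subgroup1; apply: basis_subgroup (bA _ Di0).
  + have [k [Dk ik jk _ _]] := dir _ _ Di Dj; exists k => //.
    by apply: subgroupM; [apply: basis_subgroup (bA _ Dk)|apply: ik|apply: jk].
  + by exists i => //; apply: subgroupV => //; apply: basis_subgroup (bA _ Di).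
- by move=> s [i Di Ss]; exists i => //; apply: basis_sub (bA _ Di) _ Ss.
- by move=> s [i Di Ss]; apply: basis_invol (bA _ Di) _ Ss.
- move=> B gB SB x [i Di Ax]; apply: (basis_gen (bA _ Di)) Ax => // s Ss.
  by apply: SB; exists i.
move=> H phi [phi2 phiC].
have /choice[F FE] : forall i, exists f : G -> H,
    D i -> hom_on (A i) f /\ {in S i, f =1 phi}.
  move=> i; have [Di|nDi] := pselect (D i); last by exists (fun=> 1).
  have [|f fM fE] := basis_ext (bA _ Di) (phi := phi); last by exists f.
  split=> [s Ss|s t Ss St]; first by apply: phi2; exists i.
  by apply: phiC; exists i.
have FS i s : D i -> S i s -> F i s = phi s.
  by move=> /FE[_ +] /mem_set; apply.
have Fle i k : D i -> D k -> A i `<=` A k -> S i `<=` S k ->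
    forall x, A i x -> F i x = F k x.
  move=> Di Dk ik Sik; have [[Fi _] [Fk _]] := (FE _ Di, FE _ Dk).
  apply: (basis_hom_eq (bA _ Di) Fi); first exact: hom_on_sub Fk.
  by move=> s Ss; rewrite !FS //; apply: Sik.
have Feq i j x : D i -> D j -> A i x -> A j x -> F i x = F j x.
  move=> Di Dj Aix Ajx; have [k [Dk ik jk Sik Sjk]] := dir _ _ Di Dj.
  by rewrite (Fle i k) // (Fle j k).
have /choice[idx idxE] : forall x, exists i,
    (\bigcup_(i in D) A i) x -> D i /\ A i x.
  move=> x; have [[i Di Ax]|nx] := pselect ((\bigcup_(i in D) A i) x).
    by exists i.
  by exists i0.
have FF i x : D i -> A i x -> F (idx x) x = F i x.
  by move=> Di Ax; have [|? ?] := idxE x; [exists i|apply: Feq].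
exists (fun x => F (idx x) x) => [x y [i Di Ax] [j Dj Ay]|s /set_mem[i Di Ss]].
  have [k [Dk ik jk _ _]] := dir _ _ Di Dj.
  have [Akx Aky] := (ik _ Ax, jk _ Ay).
  rewrite !(FF k) ?(FE _ Dk).1 //.
  by apply: subgroupM => //; apply: basis_subgroup (bA _ Dk).
by rewrite (FF i) ?FS //; apply: basis_sub (bA _ Di) _ Ss.
Qed.

(** * Closure properties and coherence of the class of groups *)

Section CoxeterClass.
Variable K' : graph -> Prop.
Hypothesis K'_iso : forall Gamma Delta : graph,
  isomorphic_graphs Gamma Delta -> K' Gamma -> K' Delta.
Hypothesis K'_lim : closed_under_limits (graph_class K').
Hypothesis K_rigid : forall (G : groupType) (B : set G),
  @member (coxeter_class K') G B -> strongly_rigid B.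

Local Notation in_K A := (@member (coxeter_class K') _ A).

Lemma in_KP (G : groupType) (A : set G) :
  in_K A <-> exists2 S, coxeter_basis A S & K' (coxeter_graph S).
Proof.
split=> [[S bA [Gamma KGamma /isomorphic_graphs_sym iso]]|[S bA KS]].
  by exists S => //; apply: K'_iso iso _.
exists S => //; exists (coxeter_graph S) => //.
by apply: (@isomorphic_graphs_via _ _ _ id id) => // x y _ _ <- <-.
Qed.

(** By rigidity any two bases are conjugate, so the Coxeter graph does not depend on the basis. *)
Lemma in_K_basis (G : groupType) (A S : set G) :
  in_K A -> coxeter_basis A S -> K' (coxeter_graph S).
Proof.
move=> KA bS; have [T bT KT] := (in_KP A).1 KA.
have [g Ag <-] := K_rigid KA bT bS.
apply: K'_iso KT; apply: (coxeter_graph_image (A := A)).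
- exact: basis_subgroup bT.
- exact: hom_on_sub (@conj_byM _ g).
- by move=> x y _ _; apply: conj_by_inj.
- exact: basis_sub bT.
Qed.

Lemma in_K_iso (G H : groupType) (A : set G) (B : set H) f :
  group_isom A B f -> in_K A -> in_K B.
Proof.
move=> /group_isomP[gA fM finj <-] /in_KP[S bA KS]; apply/in_KP.
exists (f @` S); first exact: basis_image.
by apply: K'_iso KS; apply: (coxeter_graph_image gA) => //; apply: basis_sub bA.
Qed.

Lemma special_iso (G H : groupType) (A B : set G) (B' : set H) f :
  group_isom B B' f -> special_subgroup A B -> special_subgroup (f @` A) B'.
Proof.
move=> /group_isomP[gB fM finj <-] [[gA _ AB] [S bB bA]].
split; first by split; [exact: (hom_on_image_subgroup gB)..|exact: image_subset].
exists (f @` S); first exact: basis_image.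
suff -> : f @` A `&` f @` S = f @` (A `&` S).
  apply: basis_image bA; first exact: hom_on_sub fM.
  by move=> x y /set_mem Ax /set_mem Ay; apply: finj; apply/mem_set/AB.
apply/seteqP; split=> [_ [[x Ax <-] [s Ss e]]|_ [s [As Ss] <-]]; last first.
  by split; exists s.
exists x => //; split=> //; rewrite -(finj _ _ _ _ e) //; apply/mem_set.
  exact: basis_sub bB _ Ss.
exact: AB.
Qed.

(** The trace on [A] of some basis [T] of [B] is conjugate to [S] by an element [g] of [A].
    Conjugation by [g] preserves both [A] and [B], so the conjugate of [T] is the basis sought. *)
Lemma special_extend (G : groupType) (A B S : set G) :
  in_K A -> special_subgroup A B -> coxeter_basis A S ->
  exists2 T, coxeter_basis B T & A `&` T = S.
Proof.
move=> KA [[gA gB AB] [T bB bA]] bS.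
have [g Ag defS] := K_rigid KA bA bS.
exists (conj_by g @` T); first by apply: basis_conj_in => //; apply: AB.
by rewrite -defS -{1}(conj_by_stable gA Ag) -conj_by_setI.
Qed.

Lemma special_basis (G : groupType) (A B S T : set G) :
  coxeter_basis A S -> coxeter_basis B T -> A `&` T = S ->
  special_subgroup A B.
Proof.
move=> bA bB AT; split; last by exists T; rewrite ?AT.
split; [exact: basis_subgroup bA|exact: basis_subgroup bB|].
apply: (basis_gen bA); first exact: basis_subgroup bB.
by rewrite -AT => x [_ /(basis_sub bB)].
Qed.

Lemma special_refl (G : groupType) (A : set G) : in_K A -> special_subgroup A A.
Proof.
move=> /in_KP[S bA _]; apply: (special_basis bA bA).
by apply/setIidr; apply: basis_sub bA.
Qed.

Lemma special_sub (G : groupType) (A B : set G) :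
  special_subgroup A B -> A `<=` B.
Proof. by move=> [[]]. Qed.

(** The basis of [B] that witnesses the first relation extends to a basis of [C], whose trace on [A]
    is the old one. *)
Lemma special_trans (G : groupType) (A B C : set G) :
  in_K B -> special_subgroup A B -> special_subgroup B C -> special_subgroup A C.
Proof.
move=> KB sAB sBC; have [[gA gB AB] [S bB bA]] := sAB.
have [T bC BT] := special_extend KB sBC bB.
apply: (special_basis bA bC).
by rewrite -BT setIA (setIidl AB).
Qed.

(** Let bases [S] and [T] of [C] witness the two relations, and let [g] conjugate [T] to [S]. Then
    [B'], the conjugate of [B], is spanned by a part [X] of [S], and [basis_conj_meet] for the
    inverse of [g] yields [h] that centralises [A] and conjugates [B'] to [B]. The conjugate of [X]
    by [h] is a basis of [B] with the right trace on [A]. *)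
Lemma special_coherent (G : groupType) (A B C : set G) : in_K C ->
  special_subgroup A C -> special_subgroup B C -> subgroup_of A B ->
  special_subgroup A B.
Proof.
move=> KC [[_ gC AC] [S bC bA]] [[_ _ BC] [T bC' bB]] [gA gB AB].
have [g Cg defS] := K_rigid KC bC' bC.
have gVB : conj_by g^-1 @` (conj_by g @` B) = B.
  rewrite image_comp -[RHS]image_id; apply: eq_imagel => x _; exact: conj_byK.
have bB' : coxeter_basis (conj_by g @` B) (conj_by g @` (B `&` T)).
  exact: basis_conj.
have XS : conj_by g @` (B `&` T) `<=` S.
  by rewrite -defS; apply: image_subset => x [].
have [b Bb hE] := basis_conj_meet bC bB' XS (subgroupV gC Cg).
rewrite gVB in hE; set h := g^-1 * b^-1 in hE.
set B' := conj_by g @` B in bB' Bb; set X := conj_by g @` (B `&` T) in bB' XS hE.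
have hB : conj_by h @` B' = B.
  have gB' := basis_subgroup bB'.
  rewrite -gVB -/B' -[in RHS](conj_by_stable gB' (subgroupV gB' Bb)).
  rewrite [RHS]image_comp; apply: eq_imagel => x _.
  by rewrite /= /conj_by /h invgM !mulgA.
have hA : forall x, A x -> conj_by h x = x.
  apply: (basis_hom_eq bA (h := id)) => // [|s [As Ss]].
    exact: hom_on_sub (@conj_byM _ h).
  by apply: (hE s Ss _).2; apply: AB.
have bBh : coxeter_basis B (conj_by h @` X) by rewrite -hB; apply: basis_conj.
apply: (special_basis bA bBh); apply/seteqP; split=> [x [Ax [y Xy yx]]|s [As Ss]].
  by split=> //; rewrite -(hA _ Ax) in yx; rewrite -(conj_by_inj yx); apply: XS.
split=> //; have [|Xs hs] := hE s Ss; first exact: AB.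
by exists s.
Qed.

(** * Coherent bases along a continuous chain *)

Section Chain.
Variables (d : Order.disp_t) (J : orderType d) (G : groupType) (A : J -> set G).
Hypothesis chainA : @continuous_chain (coxeter_class K') d J G A.

Let wfJ : well_founded (fun i j : J => (i < j)%O).
Proof. by case: chainA. Qed.

Let AK i : in_K (A i).
Proof. by case: chainA. Qed.

Let Alt i j : (i < j)%O -> special_subgroup (A i) (A j).
Proof. by case: chainA => _ _ _ + _; apply. Qed.

Let Alim j : is_limit j -> A j = \bigcup_(i in [set i | (i < j)%O]) A i.
Proof. by case: chainA => _ _ _ _; apply. Qed.

Definition coherent_at (S : J -> set G) (j : J) (T : set G) :=
  coxeter_basis (A j) T /\ forall i, (i < j)%O -> A i `&` T = S i.

(** The index set [D] is arbitrary so that the same argument covers limit stages, with [D] the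
    indices below [j], and the union of the whole chain. *)
Lemma coherent_bigcup (S : J -> set G) (D : set J) :
  D !=set0 -> (forall i, D i -> coherent_at S i (S i)) ->
  coxeter_basis (\bigcup_(i in D) A i) (\bigcup_(i in D) S i) /\
  (forall i, D i -> A i `&` \bigcup_(i in D) S i = S i).
Proof.
move=> D0 coh.
have Slt i k : D k -> (i < k)%O -> S i `<=` S k.
  by move=> /coh[_ /[apply]] <- x [].
split.
  apply: basis_bigcup => // [i j Di Dj|i /coh[]//].
  case: (Order.TotalTheory.ltgtP i j) => [ij|ji|<-]; last by exists i; split.
    exists j; split=> //; [exact: special_sub (Alt ij)|exact: Slt].
  exists i; split=> //; [exact: special_sub (Alt ji)|exact: Slt].
move=> i Di; apply/seteqP; split=> [x [Ax [k Dk Sx]]|x Sx].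
  case: (Order.TotalTheory.ltgtP i k) => [ik|ki|->//].
    by rewrite -((coh _ Dk).2 _ ik).
  exact: Slt Sx.
by split; [apply: basis_sub (coh _ Di).1 _ Sx|exists i].
Qed.

(** At the least index any basis will do, at a limit the union of the earlier bases, and at a
    successor an extension of the preceding basis. *)
Lemma coherent_step (S : J -> set G) j :
  (forall i, (i < j)%O -> coherent_at S i (S i)) -> exists T, coherent_at S j T.
Proof.
move=> coh.
have [j0|nj0] := pselect (forall i, ~ (i < j)%O).
  by have [T bT _] := (in_KP _).1 (AK j); exists T; split=> // i /j0.
have [i0 i0j] : exists i, (i < j)%O.
  by apply: contrapT => nex; apply: nj0 => i ij; apply: nex; exists i.
have [lim|nlim] := pselect (is_limit j).
  have [|bT TE] := @coherent_bigcup S [set i | (i < j)%O] _ coh; first by exists i0.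
  by exists (\bigcup_(i in [set i | (i < j)%O]) S i); split; rewrite ?Alim.
(* Neither least nor a limit, [j] has an immediate predecessor [k]. *)
have [k kj kmax] : exists2 k, (k < j)%O & forall i, (i < j)%O -> (i <= k)%O.
  apply: contrapT => nex; apply: nlim; split; first by exists i0.
  move=> i ij; apply: contrapT => nk; apply: nex; exists i => // k kj.
  case: Order.TotalTheory.leP => // ik; case: nk; exists k; exact/andP.
have [T bT AT] := special_extend (AK k) (Alt kj) (coh _ kj).1.
exists T; split=> // i /kmax; rewrite Order.POrderTheory.le_eqVlt.
move=> /orP[/eqP->//|ik].
by rewrite -((coh _ kj).2 _ ik) -AT setIA (setIidl (special_sub (Alt ik))).
Qed.

Lemma coherent_bases : exists S : J -> set G, forall j, coherent_at S j (S j).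
Proof.
pose P j (rec : forall i, (i < j)%O -> set G) (T : set G) :=
  coxeter_basis (A j) T /\ forall i (ij : (i < j)%O), A i `&` T = rec i ij.
pose step j rec : set G :=
  if pselect (exists T, P j rec T) is left h then projT1 (cid h) else set0.
(* [step] chooses a coherent basis given the earlier ones; its default [set0] is never taken, by
   [coherent_step]. *)
pose S := Fix wfJ (fun=> set G) step.
have SE j : S j = step j (fun i _ => S i).
  apply: (@Fix_eq _ _ wfJ (fun=> set G) step) => {}j f h fh; congr step.
  by apply: functional_extensionality_dep => i; apply/funext.
exists S; apply: (well_founded_ind wfJ) => j IHj.
have [T cohT] := coherent_step IHj.
rewrite SE /step; case: pselect => [h|]; first exact: (projT2 (cid h)).
by case; exists T.
Qed.

Lemma chain_limit :
  in_K (\bigcup_i A i) /\ forall j, special_subgroup (A j) (\bigcup_i A i).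
Proof.
have [S coh] := coherent_bases; have [[i0] _ _ _ _] := chainA.
have [|bU UE] := @coherent_bigcup S setT _ (fun i _ => coh i); first by exists i0.
split; last first.
  by move=> j; apply: (special_basis (coh j).1 bU); apply: UE.
apply/in_KP; exists (\bigcup_i S i) => //.
set U := \bigcup_i S i in bU UE *.
(* The bases [S i] become vertex sets in the Coxeter graph of their union [U]. Commutation being
   computed in the same [G], they carry the Coxeter graphs of the [A i], and [K'_lim] applies to
   this chain of induced subgraphs. *)
pose B i : set (coxeter_graph U) := [set x | S i (val x)].
have SU i : S i `<=` U by move=> x Sx; exists i.
have BU : isomorphic_graphs (induced (\bigcup_i B i)) (coxeter_graph U).
  apply: (@isomorphic_graphs_via (coxeter_graph U) (induced _) _
    (fun x : \bigcup_i B i => val x) id) => //.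
    rewrite range_val; apply/seteqP; split=> [x _|x _]; first by exists x.
    by have [i _ Six] := set_val_in x; exists i.
  by move=> x y _ _ <- <-.
apply: K'_iso BU _; apply: (@K'_lim d J (coxeter_graph U)); split=> //.
- move=> i; apply: K'_iso (in_K_basis (AK i) (coh i).1).
  apply: (@isomorphic_graphs_via G (coxeter_graph _) (induced _)
    (fun x : S i => val x) (fun x : B i => val (val x : U))).
  + exact: val_inj.
  + by move=> x y /val_inj/val_inj.
  + rewrite range_val; apply/seteqP; split=> [x Sx|_ [x _ <-]].
      have Ux : U x := SU _ _ Sx.
      have Bx : B i (SigSub (mem_set Ux)) by [].
      by exists (SigSub (mem_set Bx)).
    exact: (set_val_in x).
  move=> x y x' y' ex ey; rewrite /= /coxeter_adj ex ey.
  split=> -[nxy e]; split=> // xy; apply: nxy.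
    by apply: val_inj; rewrite ex ey; exact: (congr1 (fun u : U => val u) xy).
  by apply: val_inj; rewrite -ex -ey xy.
- by move=> i j ij x /=; rewrite /B /= -((coh j).2 _ ij) => -[].
move=> j limj; apply/seteqP; split=> x /=; rewrite /B /=.
  (* Continuity at a limit: a generator in [S j] lies in some earlier [A i], and the trace of [S j]
     on [A i] is [S i]. *)
  move=> Sx; have := basis_sub (coh j).1 Sx; rewrite Alim // => -[i ij Ax].
  by exists i => //=; rewrite -((coh j).2 _ ij).
by move=> [i ij]; rewrite /B /= -((coh j).2 _ ij) => -[].
Qed.

End Chain.

Lemma in_K'T (Gamma : graph) : K' (induced [set: Gamma]) <-> K' Gamma.
Proof.
split; apply: K'_iso; first exact: induced_setT.
exact/isomorphic_graphs_sym/induced_setT.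
Qed.

Lemma graph_group_in_K (Gamma : graph) :
  K' Gamma -> in_K [set: graph_group Gamma].
Proof.
move=> KGamma; apply/in_KP; exists (range (@graph_gen Gamma)).
  exact: graph_group_basis.
exact: K'_iso (graph_group_graph Gamma) KGamma.
Qed.

(** * The Löwenheim-Skolem number *)

(** Write each element of [X] as a product of generators, enclose all the letters used in a small
    subgraph of the Coxeter graph that belongs to [K'], and take the subgroup it spans. *)
Lemma LS_property_coxeter (Lambda : Type) : infinite_set [set: Lambda] ->
  LS_property (graph_class K') Lambda -> LS_property (coxeter_class K') Lambda.
Proof.
move=> Linf LS G A X KA XA; have [S bA KS] := (in_KP A).1 KA.
have /choice[sup supE] : forall x, exists l : seq G,
    A x -> (forall s, s \in l -> S s) /\ x = \prod_(s <- l) s.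
  move=> x; have [Ax|nAx] := pselect (A x); last by exists [::].
  by have [l Sl ->] := basis_prod bA Ax; exists l.
pose X' : set (coxeter_graph S) := [set s : S | exists2 x, X x & val s \in sup x].
have [||C' [KC' XC' _ cardC']] := LS (coxeter_graph S) [set: coxeter_graph S] X'.
  exact/in_K'T.
  by [].
pose Y : set G := [set val (s : S) | s in C'].
have YS : Y `<=` S by move=> _ [s _ <-]; apply: set_val_in.
have bY := basis_span bA YS.
exists (subgroup_span Y); split.
- apply/in_KP; exists Y => //; apply: K'_iso KC'.
  apply: (@isomorphic_graphs_via G (induced _) (coxeter_graph _)
    (fun x : C' => val (val x : S)) (fun y : Y => val y)) => //.
  + by move=> x y /val_inj/val_inj.
  + rewrite range_val; apply/seteqP; split=> [_ [x _ <-]|_ [s Cs <-]].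
      by exists (val x) => //; apply: set_val_in.
    by exists (SigSub (mem_set Cs)).
  move=> x y x' y' ex ey; rewrite /= /coxeter_adj -ex -ey.
  split=> -[nxy e]; split=> // xy; apply: nxy.
    by apply: val_inj; rewrite ex ey xy.
  by apply: val_inj; rewrite -ex -ey; exact: (congr1 (fun u : S => val u) xy).
- move=> x Xx; have [Sl ->] := supE _ (XA _ Xx).
  have gY := span_subgroup Y.
  have: forall s, s \in sup x -> subgroup_span Y s.
    move=> s sx; suff Ys : Y s by exact: basis_sub bY _ Ys.
    by exists (SigSub (mem_set (Sl _ sx))) => //; apply: XC'; exists x.
  elim: (sup x) => [|s l IHl] Yl; first by rewrite big_nil; exact: subgroup1 gY.
  rewrite big_cons; apply: (subgroupM gY); first by apply: (Yl); rewrite mem_head.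
  by apply: IHl => t tl; apply: (Yl); rewrite inE tl orbT.
- by apply: (special_basis bY bA); apply: basis_meet bA bY YS.
set Z := (X + _ + Lambda)%type.
have [h hinj] := (infinite_nat_inj _).1 Linf.
have Zinf : infinite_set [set: Z].
  by apply/infinite_nat_inj; exists (inr \o h) => m n [] /hinj.
have [c cinj] := seq_inj_exists Zinf.
apply: (card_generated_le Zinf bY).
apply: card_le_trans (card_image_le _ _) _; apply: card_le_trans cardC' _.
(* A letter is determined by an element of [X] and a position in its list, which bounds the number
   of letters. *)
have /choice[j jE] : forall s : X', exists xn : X * nat,
    val (val s : S) = nth 1 (sup (val xn.1)) xn.2.
  move=> s; have [x Xx sx] := set_val_in s.
  exists (SigSub (mem_set Xx), index (val (val s : S)) (sup x)).
  by rewrite nth_index.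
(* Codes of lists of lengths 2, 0 and 1 keep the three summands apart. *)
pose f (y : X' + graph_symbol + Lambda) : Z := match y with
  | inl (inl s) => c [:: inl (inl (j s).1); inr (h (j s).2)]
  | inl (inr _) => c [::]
  | inr l => c [:: inr l]
  end.
apply: (card_le_inj (f := f)) => // x y _ _.
move: x y => [[s|[]]|l] [[t|[]]|m] /cinj //; last by case=> ->.
case=> j1 /hinj j2; congr (inl (inl _)); do 2 apply: val_inj.
by rewrite !jE j1 j2.
Qed.

(** Apply the property to the group of the graph and to the generators from [X]. The resulting [C]
    is conjugate to a subgroup spanned by a set [Y] of standard generators, and the vertices in [Y]
    form the required subgraph. *)
Lemma LS_property_graph (Lambda : Type) : infinite_set [set: Lambda] ->
  LS_property (coxeter_class K') Lambda -> LS_property (graph_class K') Lambda.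
Proof.
move=> Linf LS M A X KA XA; pose Gamma := induced A.
pose gen (a : A) : graph_group Gamma := @graph_gen Gamma a.
have genI : injective gen by exact: graph_gen_inj.
pose XW := gen @` [set a : A | X (val a)].
have [||C [KC XC sC cardC]] := LS (graph_group Gamma) [set: graph_group Gamma] XW.
- exact: graph_group_in_K.
- by [].
have [[gC _ _] [T bT bC]] := sC; set S := range (@graph_gen Gamma).
have bS : coxeter_basis [set: graph_group Gamma] S := graph_group_basis Gamma.
have [g _ defS] := K_rigid (graph_group_in_K KA) bT bS.
set B := conj_by g @` C; set Y := conj_by g @` (C `&` T).
have bB : coxeter_basis B Y := basis_conj g bC.
have YS : Y `<=` S by rewrite -defS; apply: image_subset => x [].
have KB : in_K B.
  apply: (in_K_iso (f := conj_by g)) KC; apply/group_isomP; split=> //.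
    exact: hom_on_sub (@conj_byM _ g).
  by move=> x y _ _; apply: conj_by_inj.
have KY := in_K_basis KB bB.
have BC : conj_by g^-1 @` B = C.
  by rewrite image_comp -[RHS]image_id; apply: eq_imagel => x _; apply: conj_byK.
(* Conjugation might move the generators from [X] out of reach; [basis_conj_meet] shows that every
   standard generator in [C] already lies in [Y]. *)
have [b _ CY] := basis_conj_meet bS bB YS (I : [set: graph_group Gamma] g^-1).
rewrite BC in CY.
pose C0 : set M := [set m | exists2 a : A, val a = m & Y (gen a)].
have C0A : C0 `<=` A by move=> _ [a <- _]; apply: set_val_in.
pose lift (x : C0) : A := SigSub (mem_set (C0A _ (set_val_in x))).
have liftY x : Y (gen (lift x)).
  have [a ax Ya] := set_val_in x; suff <- : a = lift x by [].
  exact: val_inj.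
exists C0; split=> //.
- apply: K'_iso KY.
  apply: (@isomorphic_graphs_via (graph_group Gamma) (coxeter_graph _) (induced _)
    (fun y : Y => val y) (fun x : C0 => gen (lift x))) => //.
  + by move=> x y /genI/(congr1 val)/= /val_inj.
  + rewrite range_val; apply/seteqP; split=> [y Yy|_ [x _ <-]//].
    have [a _ ay] := YS _ Yy.
    have Ca : C0 (val a) by exists a => //; rewrite /gen ay.
    by exists (SigSub (mem_set Ca)) => //; rewrite -ay; congr graph_gen; apply: val_inj.
  move=> x y x' y' ex ey.
  rewrite /= /coxeter_adj ex ey -[adj (val x') _]/(@adj Gamma (lift x') (lift y')).
  rewrite graph_gen_adjP; split=> -[nxy e]; split=> // xy; apply: nxy.
    by apply: val_inj; rewrite ex ey.
  by rewrite -/(gen _) -/(gen _) -ex -ey xy.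
- move=> x Xx; exists (SigSub (mem_set (XA _ Xx))) => //.
  set a := SigSub _; have XWa : XW (gen a) by exists a.
  by have [] := CY (gen a); [exists a|apply: XC|].
(* Undoing the conjugation maps the vertices of [C0] injectively into [C], whose size is bounded. *)
have /choice[f fE] : forall m : M, exists w, C0 m -> exists a : A,
    [/\ val a = m, Y (gen a) & w = conj_by g^-1 (gen a)].
  move=> m; have [[a am Ya]|nm] := pselect (C0 m); last by exists 1.
  by exists (conj_by g^-1 (gen a)) => _; exists a.
have C0C : C0 #<= C.
  apply: (card_le_inj (f := f)) => [m /fE[a [_ Ya ->]]|m m'].
    by rewrite -BC; exists (gen a) => //; apply: basis_sub bB _ Ya.
  move=> /set_mem/fE[a [<- _ ->]] /set_mem/fE[a' [<- _ ->]].
  by move=> /conj_by_inj/genI ->.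
apply: card_le_trans C0C _; apply: card_le_trans cardC _.
have [h hinj] := (infinite_nat_inj _).1 Linf; have [c cinj] := seq_inj_exists Linf.
have /choice[k kE] : forall w : XW, exists x : X, exists2 a : A,
    val a = val x & gen a = val w.
  move=> w; have [a Xa aw] := set_val_in w.
  by exists (SigSub (mem_set (Xa : X (val a)))), a.
(* The three group symbols become codes of one-element lists and [Lambda] those of two-element
   lists, so the images are disjoint. *)
pose F (y : XW + group_symbol + Lambda) : X + graph_symbol + Lambda := match y with
  | inl (inl w) => inl (inl (k w))
  | inl (inr sym_one) => inr (c [:: h 0%N])
  | inl (inr sym_mul) => inr (c [:: h 1%N])
  | inl (inr sym_inv) => inr (c [:: h 2%N])
  | inr l => inr (c [:: l; l])
  end.
apply: (card_le_inj (f := F)) => // x y _ _.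
move: x y => [[w|[]]|l] [[w'|[]]|l'] //=.
  move=> [kw]; congr (inl (inl _)); apply: val_inj.
  have [a ax <-] := kE w; have [a' ax' <-] := kE w'.
  by congr gen; apply: val_inj; rewrite ax ax' kw.
all: by move=> [/cinj]; first [by []|by case=> /hinj|by case=> ->].
Qed.

Lemma is_LS_coxeter (Lambda : Type) :
  is_LS (coxeter_class K') Lambda <-> is_LS (graph_class K') Lambda.
Proof.
split=> -[Linf LS Lmin]; split=> // [|Mu Minf LSM].
- exact: LS_property_graph.
- exact/Lmin/LS_property_coxeter.
- exact: LS_property_coxeter.
- exact/Lmin/LS_property_graph.
Qed.

(** * Amalgamation, joint embedding and large models *)

(** Passes from graphs back to groups, once the Coxeter graphs have been embedded in [Gamma]. *)
Lemma graph_group_embedding (B : groupType) (T : set B) (Gamma : graph)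
    (f : coxeter_graph T -> Gamma) :
  coxeter_basis [set: B] T ->
  @strong_embedding (graph_class K') (coxeter_graph T) Gamma f ->
  exists2 F : B -> graph_group Gamma,
    @strong_embedding (coxeter_class K') B (graph_group Gamma) F &
    forall s : T, F (val s) = graph_gen (f s).
Proof.
move=> bT [[[_ finj _] fadj] _].
pose phi x := if pselect (T x) is left h then graph_gen (f (SigSub (mem_set h))) else 1.
have phiE (s : T) : phi (val s) = graph_gen (f s).
  rewrite /phi; case: pselect => [h|]; last by have := set_val_in s.
  by congr (graph_gen (f _)); apply: val_inj.
have fI s t : f s = f t -> s = t by apply: finj; apply/mem_set.
have [||s t Ts Tt|F [Fiso Fsp FE]] :=
    basis_embedding bT (graph_group_basis Gamma) (f := phi).
- move=> s t /set_mem Ts /set_mem Tt.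
  rewrite (phiE (SigSub (mem_set Ts))) (phiE (SigSub (mem_set Tt))).
  by move=> /graph_gen_inj/fI [].
- by move=> _ [s Ts <-]; rewrite (phiE (SigSub (mem_set Ts))); eexists.
- set s' : coxeter_graph T := SigSub (mem_set Ts).
  set t' : coxeter_graph T := SigSub (mem_set Tt).
  have [->//|nst] := pselect (s = t).
  have nst' : s' <> t' by case.
  have nfst : graph_gen (f s') <> graph_gen (f t') by move=> /graph_gen_inj/fI.
  rewrite (phiE s') (phiE t'); split=> e.
    by have /fadj : adj s' t' by []; move=> /(_ I I)/graph_gen_adjP[].
  have /graph_gen_adjP : graph_gen (f s') <> graph_gen (f t') /\ _ := conj nfst e.
  by move=> /(fadj _ _ I I)[].
exists F; first by split.
by move=> s; rewrite FE ?phiE //; apply: set_val_in.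
Qed.

Lemma coxeter_graph_embedding (A B : groupType) (S : set A) (T : set B)
    (e : A -> B) (eST : forall s : S, T (e (val s))) :
  hom_on [set: A] e -> injective e ->
  @strong_embedding (graph_class K') (coxeter_graph S) (coxeter_graph T)
    (fun s : S => SigSub (mem_set (eST s))).
Proof.
move=> eM eI; split; last by [].
have I' : injective (fun s : S => SigSub (mem_set (eST s)) : T).
  by move=> s t [] /eI/val_inj.
split; first by split=> // s t _ _ /I'.
move=> s t _ _; rewrite /= /coxeter_adj /= -!eM //.
split=> -[nst st]; split.
- by move=> /I'.
- by rewrite st.
- by move=> ste; apply: nst; rewrite ste.
- exact: eI.
Qed.

(** Extend the images of one basis of [A] to bases of [B0] and [B1], amalgamate the Coxeter graphs,
    and take the group of the amalgam. The two composites agree on the basis of [A], hence on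
    [A]. *)
Lemma amalgamation_coxeter :
  amalgamation_property (graph_class K') -> amalgamation_property (coxeter_class K').
Proof.
move=> AP A B0 B1 e0 e1 KA KB0 KB1 [iso0 sp0] [iso1 sp1].
have [S bA KS] := (in_KP _).1 KA.
have lift (B : groupType) (e : A -> B) : in_K [set: B] ->
    group_isom [set: A] (range e) e -> special_subgroup (range e) [set: B] ->
    exists T : set B, [/\ coxeter_basis [set: B] T, K' (coxeter_graph T),
      hom_on [set: A] e, injective e & forall s : S, T (e (val s))].
  move=> KB iso sp; have Kr : in_K (range e) by apply: in_K_iso iso KA.
  have /group_isomP[_ eM einj _] := iso.
  have [T bT eT] := special_extend Kr sp (basis_image eM einj bA).
  exists T; split=> //; first exact: in_K_basis bT.
    by move=> x y; apply: einj; apply/mem_set.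
  move=> s; have : (e @` S) (e (val s)) by exists (val s) => //; apply: set_val_in.
  by rewrite -eT => -[].
have [T0 [bT0 KT0 e0M e0I e0S]] := lift _ _ KB0 iso0 sp0.
have [T1 [bT1 KT1 e1M e1I e1S]] := lift _ _ KB1 iso1 sp1.
have [|||||Gamma [f0 [f1 [KGamma sf0 sf1 fe]]]] :=
  AP (coxeter_graph S) (coxeter_graph T0) (coxeter_graph T1)
     (fun s : S => SigSub (mem_set (e0S s))) (fun s : S => SigSub (mem_set (e1S s))).
- exact/in_K'T.
- exact/in_K'T.
- exact/in_K'T.
- exact: coxeter_graph_embedding.
- exact: coxeter_graph_embedding.
have [F0 sF0 F0E] := graph_group_embedding bT0 sf0.
have [F1 sF1 F1E] := graph_group_embedding bT1 sf1.
exists (graph_group Gamma), F0, F1; split=> //.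
  exact/graph_group_in_K/in_K'T.
have [/group_isomP[_ F0M _ _] _] := sF0.
have [/group_isomP[_ F1M _ _] _] := sF1.
move=> a; apply: (basis_hom_eq bA (f := F0 \o e0) (h := F1 \o e1)) => //.
- exact: hom_on_comp e0M _ F0M.
- exact: hom_on_comp e1M _ F1M.
move=> s Ss /=.
have := fe (SigSub (mem_set Ss)) => /(congr1 (@graph_gen Gamma)).
by rewrite -F0E -F1E.
Qed.

Lemma joint_embedding_coxeter :
  joint_embedding_property (graph_class K') ->
  joint_embedding_property (coxeter_class K').
Proof.
move=> JEP B0 B1 /in_KP[T0 bT0 KT0] /in_KP[T1 bT1 KT1].
have [||Gamma [f0 [f1 [KGamma sf0 sf1]]]] :=
  JEP (coxeter_graph T0) (coxeter_graph T1); [exact/in_K'T|exact/in_K'T|].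
have [F0 sF0 _] := graph_group_embedding bT0 sf0.
have [F1 sF1 _] := graph_group_embedding bT1 sf1.
exists (graph_group Gamma), F0, F1; split=> //.
exact/graph_group_in_K/in_K'T.
Qed.

(** The group of a graph of infinite cardinality has the cardinality of the graph: generators are
    distinct, and elements are finite products of them. *)
Lemma large_models_coxeter :
  arbitrarily_large_models (graph_class K') ->
  arbitrarily_large_models (coxeter_class K').
Proof.
move=> [Kappa LSK large]; exists Kappa; first exact/is_LS_coxeter.
move=> Lambda KL; have [Gamma KGamma cardG] := large _ KL.
exists (graph_group Gamma); first exact/graph_group_in_K/in_K'T.
have Linf : infinite_set [set: Lambda].
  by move=> Lfin; have [+ _ _] := LSK; apply; apply: card_le_finite KL Lfin.
have /andP[GL LG] : ([set: Gamma] #<= [set: Lambda]) && ([set: Lambda] #<= [set: Gamma]).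
  by rewrite -card_eq_le.
rewrite card_eq_le; apply/andP; split.
  apply: (card_generated_le Linf (graph_group_basis Gamma)).
  exact: card_le_trans (card_image_le _ _) GL.
apply: card_le_trans LG _; apply: (card_le_inj (f := @graph_gen Gamma)) => //.
by move=> x y _ _; apply: graph_gen_inj.
Qed.

End CoxeterClass.

Theorem theorem5p2 (K' : graph -> Prop)
    (K'_iso : forall Gamma Delta : graph,
       isomorphic_graphs Gamma Delta -> K' Gamma -> K' Delta)
    (K'_lim : closed_under_limits (graph_class K'))
    (K_rigid : forall (G : groupType) (B : set G),
       @member (coxeter_class K') G B -> strongly_rigid B) :
  (* (1) *)
  (member_iso_closed (coxeter_class K') /\
   strong_iso_closed (coxeter_class K')) /\
  (* (2) *)
  (forall (G : groupType) (A B : set G),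
     @strong (coxeter_class K') G A B -> subgroup_of A B) /\
  (* (3) *)
  strong_partial_order (coxeter_class K') /\
  (* (4.1) *)
  closed_under_limits (coxeter_class K') /\
  (* (4.2) *)
  strong_in_limits (coxeter_class K') /\
  (* (5) *)
  (forall (G : groupType) (A B C : set G),
     @member (coxeter_class K') G A -> @member (coxeter_class K') G B ->
     @member (coxeter_class K') G C ->
     @strong (coxeter_class K') G A C -> @strong (coxeter_class K') G B C ->
     subgroup_of A B -> @strong (coxeter_class K') G A B) /\
  (* LS(K_*, <=) = LS(K', <=) *)
  (forall Lambda : Type,
     is_LS (coxeter_class K') Lambda <-> is_LS (graph_class K') Lambda) /\
  (amalgamation_property (graph_class K') /\
   joint_embedding_property (graph_class K') /\
   arbitrarily_large_models (graph_class K') ->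
   amalgamation_property (coxeter_class K') /\
   joint_embedding_property (coxeter_class K') /\
   arbitrarily_large_models (coxeter_class K')).
Proof.
split; first by split=> [M N A B f|M N A B B' f]; [apply: in_K_iso|apply: special_iso].
split; first by move=> G A B [].
split.
  move=> G; split=> [A|A B _ _ sAB sBA|A B C _ KB _].
  - exact: (special_refl K'_iso).
  - by apply/seteqP; split; apply: special_sub.
  - exact: (special_trans K_rigid).
split; first by move=> d I G A /(chain_limit K'_iso K'_lim K_rigid)[].
split; first by move=> d I G A /(chain_limit K'_iso K'_lim K_rigid)[].
split; first by move=> G A B C _ _ KC; apply: (special_coherent K_rigid).
split; first exact: is_LS_coxeter.
move=> [AP [JEP large]]; split; first exact: amalgamation_coxeter.
by split; [apply: joint_embedding_coxeter|apply: large_models_coxeter].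
Qed.
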